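(* Let $X$ be a smooth projective toric variety with torus $T$ and cocharacter lattice $N$, and assume $v\in N$ is admissible. Then $v$ stratifies $X$ if and only if $v$ stratifies each $2$-dimensional $T$-stable subvariety of $X$.
   Context: Work over an algebraically closed field $\mathbb{K}$; subvarieties are closed and irreducible. $X$ is the projective toric variety defined by the outer normal fan of a smooth full-dimensional lattice polytope $P\subset M_{\mathbb{R}}$, where $M=\mathrm{Hom}(T,\mathbb{G}_m)$ and $N=\mathrm{Hom}(\mathbb{G}_m,T)$. $T$-stable subvarieties of $X$ are the $T$-orbit closures, and correspond to faces of $P$ of the same dimension; each is itself a smooth projective toric variety. A cocharacter $v\in N$ is admissible if $X^{\mathbb{G}_m}=X^T$ for the induced $\mathbb{G}_m$-action (equivalently, $v$ is not perpendicular to any edge of $P$). For admissible $v$, the (positive) Białynicki-Birula decomposition is $X=\bigsqcup_{p\in X^T}X_p^+$ with $X_p^+=\{x\in X:\lim_{t\to0}v(t)\cdot x=p\}$; $v$ stratifies $X$ if this decomposition is a stratification, i.e. the closure of each cell is a union of cells. For a $T$-stable subvariety $Y\subseteq X$, ''$v$ stratifies $Y$'' means that the Białynicki-Birula decomposition $\{Y_p^+\}_{p\in Y^T}$ of $Y$, for the restriction to $Y$ of the $\mathbb{G}_m$-action induced by $v$, is a stratification. *)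

(* Defs.v *)
From HB Require Import structures.
From mathcomp Require Import all_boot all_order all_algebra.
From mathcomp Require Import all_classical reals topology.

Set Implicit Arguments.
Unset Strict Implicit.
Unset Printing Implicit Defensive.
Import Order.TTheory GRing.Theory Num.Theory.
Local Open Scope classical_set_scope.
Local Open Scope ring_scope.

(* M = Z^n and N = Z^n are both 'rV[int]_n, M_R and N_R are both 'rV[R]_n;
   [pairing] is the duality pairing <m, u>, over Z or over R. *)
Definition pairing (A : pzRingType) n (m u : 'rV[A]_n) : A :=
  \sum_i m 0 i * u 0 i.

Definition toR (R : realType) n (m : 'rV[int]_n) : 'rV[R]_n :=
  map_mx intr m.

Section LatticePolytopes.
Context {R : realType} {n : nat}.
Implicit Types (P F : set 'rV[R]_n) (p w : 'rV[int]_n).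

Definition hull k (s : 'I_k -> 'rV[R]_n) : set 'rV[R]_n :=
  [set x | exists l : 'I_k -> R,
     [/\ forall i, 0 <= l i, \sum_i l i = 1 & x = \sum_i l i *: s i]].

Definition lattice_polytope P : Prop :=
  exists k (s : 'I_k -> 'rV[int]_n), P = hull (fun i => toR R (s i)).

(* F contains d + 1 affinely independent points *)
Definition aff_dim_ge F d : Prop :=
  exists (x0 : 'rV[R]_n) (A : 'M[R]_(d, n)),
    [/\ F x0, forall i, F (x0 + row i A) & row_free A].

Definition aff_dim F d : Prop := aff_dim_ge F d /\ ~ aff_dim_ge F d.+1.

(* nonempty faces, P itself included (u = 0) *)
Definition face P F : Prop :=
  F !=set0 /\
  exists u : 'rV[R]_n,
    F = [set x | P x /\ forall y, P y -> pairing y u <= pairing x u].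

Definition vertex P p : Prop := face P [set toR R p].

Definition edge P F : Prop := face P F /\ aff_dim F 1.

Definition primitive w : Prop :=
  forall (d : int) (w' : 'rV[int]_n), w = d *: w' -> d \is a GRing.unit.

Definition primitive_edge_vector P p w : Prop :=
  primitive w /\
  exists E, [/\ edge P E, E (toR R p) & E (toR R (p + w))].

(* at each vertex, the primitive edge vectors form a Z-basis of M *)
Definition smooth_polytope P : Prop :=
  forall p, vertex P p ->
    exists2 B : 'M[int]_n, B \in unitmx &
      [set w | primitive_edge_vector P p w] = range (fun i => row i B).

Definition smooth_full_dim_lattice_polytope P : Prop :=
  [/\ lattice_polytope P, aff_dim P n & smooth_polytope P].

Definition outer_normal_cone P F : set 'rV[R]_n :=
  [set u | forall x y, F x -> P y -> pairing y u <= pairing x u].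

Definition outer_normal_fan P : set (set 'rV[R]_n) :=
  [set s | exists2 F, face P F & s = outer_normal_cone P F].

End LatticePolytopes.

(* The toric variety of a fan, as the space of its K-points: the affine charts
   U_s (monoid morphisms from s^vee /\ M to multiplicative K) glued along U_(s /\ s') for s, s' in
   the fan. *)
Section ToricVariety.
Context {R : realType} {n : nat} (K : fieldType).
Implicit Types (s : set 'rV[R]_n) (g d : 'rV[int]_n -> K).

Definition dual_monoid s : set 'rV[int]_n :=
  [set m | forall u, s u -> 0 <= pairing (toR R m) u].

(* An element of U_s is represented by any function on M that restricts to a
   monoid morphism on s^vee /\ M; its values elsewhere are irrelevant, and
   are identified by [glue]. *)
Definition chart s : set ('rV[int]_n -> K) :=
  [set g | g 0 = 1 /\
     forall m m', dual_monoid s m -> dual_monoid s m' ->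
       g (m + m') = g m * g m'].

Definition chart_point : Type := set 'rV[R]_n * ('rV[int]_n -> K).

Context (Sigma : set (set 'rV[R]_n)).

Definition is_chart_point (a : chart_point) : Prop :=
  Sigma a.1 /\ chart a.1 a.2.

(* both come from one point of U_(s /\ s') *)
Definition glue (a b : chart_point) : Prop :=
  [/\ is_chart_point a, is_chart_point b &
      exists d, [/\ chart (a.1 `&` b.1) d,
        forall m, dual_monoid a.1 m -> d m = a.2 m &
        forall m, dual_monoid b.1 m -> d m = b.2 m]].

(* points are the gluing classes, as sets of chart points *)
Definition toric_variety : Type :=
  {x : set chart_point | exists2 a, is_chart_point a & x = glue a}.

(* x lies in U_s, with coordinates chi^m(x) = g m for m in s^vee /\ M *)
Definition coords (x : toric_variety) s g : Prop := sval x (s, g).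

(* the regular function \sum c chi^m on U_s, for (c, m) in f *)
Definition regular s (f : seq (K * 'rV[int]_n)) : Prop :=
  forall c, c \in f -> dual_monoid s c.2.

Definition eval_regular (f : seq (K * 'rV[int]_n)) g : K :=
  \sum_(c <- f) c.1 * g c.2.

Definition zariski_closed (Z : set toric_variety) : Prop :=
  forall s, Sigma s ->
    exists2 J : set (seq (K * 'rV[int]_n)), J `<=` regular s &
      forall x g, coords x s g ->
        (Z x <-> forall f, J f -> eval_regular f g = 0).

Lemma coords_chart x s g : coords x s g -> chart s g.
Proof. by rewrite /coords; case: (svalP x) => a _ -> [_ []]. Qed.

Lemma dual_monoid0 s : dual_monoid s 0.
Proof.
move=> u _; rewrite /pairing big1 // => i _.
by rewrite !mxE mul0r.
Qed.

Lemma dual_monoidD s m m' :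
  dual_monoid s m -> dual_monoid s m' -> dual_monoid s (m + m').
Proof.
move=> sm sm' u su.
have := addr_ge0 (sm u su) (sm' u su); rewrite /pairing -big_split /=.
suff -> : \sum_i toR R (m + m') 0 i * u 0 i =
  \sum_i (toR R m 0 i * u 0 i + toR R m' 0 i * u 0 i) by [].
by apply: eq_bigr => i _; rewrite !mxE rmorphD mulrDl.
Qed.

Lemma zariski_closed0 : zariski_closed set0.
Proof.
move=> s _; exists [set [:: (1, 0)]].
  by move=> _ -> c; rewrite inE => /eqP ->; exact: dual_monoid0.
move=> x g /coords_chart [g0 _]; split=> // /(_ _ erefl) /eqP.
by rewrite /eval_regular big_seq1 g0 mul1r oner_eq0.
Qed.

Lemma zariski_closedI (I : Type) (F : I -> set toric_variety) :
  (forall i, zariski_closed (F i)) -> zariski_closed (\bigcap_i F i).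
Proof.
move=> Fc s ss.
pose J i := projT1 (cid2 (Fc i s ss)).
exists (\bigcup_i J i) => [f [i _]|x g xg].
  by rewrite /J; case: cid2 => /= ? + _; apply.
split=> [Fx f [i _]|JF i _].
  by rewrite /J; case: cid2 => /= J' _ /(_ x g xg) [+ _]; apply; exact: Fx.
have {}JF f : projT1 (cid2 (Fc i s ss)) f -> eval_regular f g = 0.
  by move=> Jf; apply: JF; exists i.
by move: JF; case: cid2 => /= J' _ /(_ x g xg) [_].
Qed.

Lemma zariski_closedU (A B : set toric_variety) :
  zariski_closed A -> zariski_closed B -> zariski_closed (A `|` B).
Proof.
move=> Ac Bc s ss; have [J Js AJ] := Ac s ss; have [L Ls BL] := Bc s ss.
pose mul (f h : seq (K * 'rV[int]_n)) :=
  [seq (c.1 * e.1, c.2 + e.2) | c <- f, e <- h].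
have mulE x g f h : coords x s g -> J f -> L h ->
    eval_regular (mul f h) g = eval_regular f g * eval_regular h g.
  move=> /coords_chart [_ gM] /Js fs /Ls hs.
  rewrite /eval_regular big_allpairs_dep /= mulr_suml.
  apply: eq_big_seq => c cf; rewrite mulr_sumr; apply: eq_big_seq => e eh /=.
  by rewrite (gM _ _ (fs _ cf) (hs _ eh)) mulrACA.
exists [set k | exists f h, [/\ J f, L h & k = mul f h]].
  move=> _ [f] [h] [/Js fs /Ls hs ->] c /allpairsP[[c1 c2] /= [c1f c2h ->]].
  by apply: dual_monoidD; [exact: fs|exact: hs].
move=> x g xg; split=> [[Ax|Bx] _ [f] [h] [Jf Lh ->]|JLx].
- by rewrite (mulE x) // ((AJ x g xg).1 Ax f Jf) mul0r.
- by rewrite (mulE x) // ((BL x g xg).1 Bx h Lh) mulr0.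
- apply: contrapT => /not_orP[].
  move=> /(contra_not (AJ x g xg).2) /existsNP[f /not_implyP[Jf f0]].
  move=> /(contra_not (BL x g xg).2) /existsNP[h /not_implyP[Lh h0]].
  have /eqP := JLx _ (ex_intro _ f (ex_intro _ h (And3 Jf Lh erefl))).
  by rewrite (mulE x) // mulf_eq0 => /orP[] /eqP.
Qed.

HB.instance Definition _ := gen_eqMixin toric_variety.
HB.instance Definition _ := gen_choiceMixin toric_variety.

Definition zariski_open (O : set toric_variety) : Prop :=
  zariski_closed (~` O).

Let zopenT : zariski_open setT.
Proof. by rewrite /zariski_open setCT; exact: zariski_closed0. Qed.

Let zopenI : setI_closed zariski_open.
Proof.
by move=> A B Ao Bo; rewrite /zariski_open setCI; exact: zariski_closedU.
Qed.

Let zopenU (I : Type) (F : I -> set toric_variety) :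
  (forall i, zariski_open (F i)) -> zariski_open (\bigcup_i F i).
Proof.
by move=> Fo; rewrite /zariski_open setC_bigcup; exact: zariski_closedI.
Qed.

HB.instance Definition _ :=
  isOpenTopological.Build toric_variety zopenT zopenI zopenU.

Lemma toric_closedE (Z : set toric_variety) : closed Z <-> zariski_closed Z.
Proof. by rewrite -openC -{2}(setCK Z). Qed.

Definition Gm : Type := {t : K | t != 0}.

(* T = Gm^n, with M = Z^n its lattice of characters chi^m *)
Definition torus : Type := 'I_n -> Gm.

Definition chi (m : 'rV[int]_n) (t : torus) : K := \prod_i val (t i) ^ m 0 i.

Definition cochar (v : 'rV[int]_n) (t : Gm) : torus :=
  fun i => exist _ (val t ^ v 0 i) (expfz_neq0 (v 0 i) (svalP t)).

Definition chart_act (t : torus) (a : chart_point) : chart_point :=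
  (a.1, fun m => chi m t * a.2 m).

Lemma chi_neq0 m t : chi m t != 0.
Proof. by apply/prodf_neq0 => i _; apply: expfz_neq0; exact: (svalP (t i)). Qed.

Lemma chi0 t : chi 0 t = 1.
Proof. by rewrite /chi big1 // => i _; rewrite mxE expr0z. Qed.

Lemma chiD m m' t : chi (m + m') t = chi m t * chi m' t.
Proof.
rewrite /chi -big_split /=; apply: eq_bigr => i _.
by rewrite mxE expfzDr //; exact: (svalP (t i)).
Qed.

Lemma chart_chi t s g : chart s g -> chart s (fun m => chi m t * g m).
Proof.
move=> [g0 gM]; split; first by rewrite chi0 g0 mulr1.
by move=> m m' sm sm'; rewrite chiD gM // mulrACA.
Qed.

Lemma chart_chiV t s g : chart s g -> chart s (fun m => (chi m t)^-1 * g m).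
Proof.
move=> [g0 gM]; split; first by rewrite chi0 g0 invr1 mulr1.
by move=> m m' sm sm'; rewrite chiD gM // invfM mulrACA.
Qed.

Lemma image_chart_act t a : is_chart_point a ->
  chart_act t @` glue a = glue (chart_act t a).
Proof.
move=> [a1 a2]; apply/seteqP; split=> [_ [b [_ [b1 b2] [d [d0 da db]]] <-]|b].
  split; [by split => //; exact: chart_chi..|].
  exists (fun m => chi m t * d m); split; first exact: chart_chi.
  - by move=> m /da /= ->.
  - by move=> m /db /= ->.
move=> [_ [b1 b2] [d [d0 da db]]].
exists (b.1, fun m => (chi m t)^-1 * b.2 m).
  split; [by []|by split => //; exact: chart_chiV|].
  exists (fun m => (chi m t)^-1 * d m); split; first exact: chart_chiV.
  - by move=> m /da /= ->; rewrite mulKf // chi_neq0.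
  - by move=> m /db /= ->.
case: b {b1 b2 d0 da db} => b1 b2; congr pair; apply/funext => m /=.
by rewrite mulVKf // chi_neq0.
Qed.

Lemma act_subproof (t : torus) (x : toric_variety) :
  exists2 a, is_chart_point a & chart_act t @` sval x = glue a.
Proof.
have [a [a1 a2] ->] := svalP x; exists (chart_act t a).
  by split => //; exact: chart_chi.
by rewrite image_chart_act.
Qed.

(* the torus action: (t . g) m = chi^m(t) * g m on each chart *)
Definition act (t : torus) (x : toric_variety) : toric_variety :=
  exist _ (chart_act t @` sval x) (act_subproof t x).

Definition fixed_T : set toric_variety := [set x | forall t, act t x = x].

Definition fixed_Gm v : set toric_variety :=
  [set x | forall t, act (cochar v t) x = x].

Definition admissible v : Prop := fixed_Gm v = fixed_T.

(* phi is a morphism from the affine line A^1 to the toric variety: near each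
   z, on a principal open set h <> 0, it maps into a chart, with coordinates
   of the form f / h^k *)
Definition A1_morphism (phi : K -> toric_variety) : Prop :=
  forall z, exists s (h : {poly K}), [/\ Sigma s, h.[z] != 0 &
    exists2 g : K -> 'rV[int]_n -> K,
      forall t, h.[t] != 0 -> coords (phi t) s (g t) &
      forall m, dual_monoid s m -> exists (f : {poly K}) k,
        forall t, h.[t] != 0 -> g t m = f.[t] / h.[t] ^+ k].

(* lim_(t -> 0) v(t) . x = p *)
Definition lim_at0 v (x p : toric_variety) : Prop :=
  exists phi, [/\ A1_morphism phi, phi 0 = p &
    forall t : Gm, phi (val t) = act (cochar v t) x].

(* the cell Y_p^+ *)
Definition BB_cell v (Y : set toric_variety) p : set toric_variety :=
  [set x | Y x /\ lim_at0 v x p].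

(* the closure of each cell, taken in Y, is a union of cells *)
Definition stratifies v (Y : set toric_variety) : Prop :=
  forall p, (Y `&` fixed_T) p ->
    exists2 I : set toric_variety, I `<=` Y `&` fixed_T &
      Y `&` closure (BB_cell v Y p) = \bigcup_(q in I) BB_cell v Y q.

Definition T_stable (Y : set toric_variety) : Prop :=
  forall t x, Y x -> Y (act t x).

End ToricVariety.

Section Dimension.
Context {X : topologicalType}.
Implicit Types Y Z : set X.

Definition irreducible Z : Prop :=
  Z !=set0 /\
  forall A B, closed A -> closed B -> Z `<=` A `|` B -> Z `<=` A \/ Z `<=` B.

Definition subvariety Y : Prop := closed Y /\ irreducible Y.

(* a chain Z_0 < ... < Z_d of subvarieties inside Y *)
Definition dim_ge Y d : Prop :=
  exists Z : nat -> set X,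
    (forall i, (i <= d)%N -> subvariety (Z i) /\ Z i `<=` Y) /\
    (forall i, (i < d)%N -> Z i `<` Z i.+1).

(* the Krull dimension of the closed set Y is d *)
Definition krull_dim Y d : Prop := dim_ge Y d /\ ~ dim_ge Y d.+1.

End Dimension.

(* Main.v *)
(** Write [L_p] for the set of lattice points of the face of [P] spanned by the
    edges at the vertex [p] along which [v] decreases.  A point of the orbit of a
    face [F] flows to the fixed point of the vertex of [F] that maximises [v], so
    the cell of [p] consists of the orbits of the faces of [L_p] through [p], and
    its closure is the [T]-stable subvariety of [L_p].  Hence [v] stratifies the
    subvariety of a face [A] iff [L_q] meets [A] inside [L_p] for all vertices
    [p, q] of [A] with [q] in [L_p].

    This condition follows from its instances on the 2-faces by induction on [q],
    downwards along [v]: if [q <> p] lies in [L_p], some up edge [i] at [q] stays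
    in [L_p], and its top vertex [q'] satisfies [L_q' <= L_p] by induction.  A
    down edge [j] at [q] spans with [i] a 2-face in which [q] lies in [L_q'],
    so [j] lies in [L_q'], hence in [L_p].

    Points are handled through homogeneous coordinates indexed by the lattice
    points of [P]; their supports are the faces of [P].  That the subvariety of
    a 2-face has dimension 2 follows from the algebraic dependence of any three
    regular functions on it. *)

Require Import Defs.
From mathcomp Require Import all_boot all_order all_algebra.
From mathcomp Require Import all_classical reals topology.
From mathcomp Require Import ring lra zify.

Set Implicit Arguments.
Unset Strict Implicit.
Unset Printing Implicit Defensive.
Import Order.TTheory GRing.Theory Num.Theory.
Local Open Scope classical_set_scope.
Local Open Scope ring_scope.

(** * Lattice polytopes *)

(** Smoothness gives every vertex a basis of [M] made of edge vectors, so [U_p] is an affine space,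
    a face through [p] is a set of edge directions, and questions about faces become sign questions
    about integer coordinates. The bases at different vertices are unrelated, whereas the induction
    and the closures compare faces seen from different vertices. Faces are therefore stored as sets
    of lattice points, and [fset_rebase] changes the vertex. The same indexing serves the geometry:
    a change of vertex multiplies all homogeneous coordinates by one nonzero scalar, so supports do
    not depend on the chart. Smoothness speaks of edges only; that [P] lies in the cone spanned by
    the edges at a vertex is derived from Farkas' lemma. Dimension is defined by chains of
    subvarieties, so its upper bound is a count: three functions on the surface have [N ^ 3]
    monomials with exponents below [N], but these involve only on the order of [N ^ 2] characters in
    the plane of the 2-face. *)

Section Pairing.
Context {A : comPzRingType} {n : nat}.
Implicit Types m u w : 'rV[A]_n.

Lemma pairingC m u : pairing m u = pairing u m.
Proof. by apply: eq_bigr => i _; rewrite mulrC. Qed.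

Lemma pairing0l u : pairing 0 u = 0.
Proof. by rewrite /pairing big1 // => i _; rewrite mxE mul0r. Qed.

Lemma pairing0r m : pairing m 0 = 0.
Proof. by rewrite pairingC pairing0l. Qed.

Lemma pairingDl m w u : pairing (m + w) u = pairing m u + pairing w u.
Proof. by rewrite -big_split; apply: eq_bigr => i _; rewrite mxE mulrDl. Qed.

Lemma pairingZl c m u : pairing (c *: m) u = c * pairing m u.
Proof. by rewrite mulr_sumr; apply: eq_bigr => i _; rewrite mxE mulrA. Qed.

Lemma pairingNl m u : pairing (- m) u = - pairing m u.
Proof. by rewrite -scaleN1r pairingZl mulN1r. Qed.

Lemma pairingBl m w u : pairing (m - w) u = pairing m u - pairing w u.
Proof. by rewrite pairingDl pairingNl. Qed.

Lemma pairingDr m w u : pairing u (m + w) = pairing u m + pairing u w.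
Proof. by rewrite pairingC pairingDl !(pairingC u). Qed.

Lemma pairingZr c m u : pairing u (c *: m) = c * pairing u m.
Proof. by rewrite pairingC pairingZl (pairingC u). Qed.

Lemma pairingNr m u : pairing u (- m) = - pairing u m.
Proof. by rewrite pairingC pairingNl (pairingC u). Qed.

Lemma pairing_suml I r (Q : pred I) (F : I -> 'rV[A]_n) u :
  pairing (\sum_(i <- r | Q i) F i) u = \sum_(i <- r | Q i) pairing (F i) u.
Proof.
apply: (big_morph (fun x => pairing x u)) => [x y|]; first exact: pairingDl.
exact: pairing0l.
Qed.

End Pairing.

Section ToR.
Context {R : realType} {n : nat}.
Implicit Types m u w : 'rV[int]_n.

Lemma pairing_toR m u : pairing (toR R m) (toR R u) = (pairing m u)%:~R.
Proof. by rewrite rmorph_sum; apply: eq_bigr => i _; rewrite !mxE rmorphM. Qed.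

Lemma toRB m u : toR R (m - u) = toR R m - toR R u.
Proof. exact: map_mxB. Qed.

Lemma toRD m u : toR R (m + u) = toR R m + toR R u.
Proof. exact: map_mxD. Qed.

Lemma toRZ c m : toR R (c *: m) = c%:~R *: toR R m.
Proof. exact: map_mxZ. Qed.

Lemma toR_inj : injective (toR R (n := n)).
Proof.
by move=> m u /rowP mu; apply/rowP => i; have := mu i; rewrite !mxE => /intr_inj.
Qed.

Lemma pairing_gt0 (x : 'rV[R]_n) : x != 0 -> 0 < pairing x x.
Proof.
move=> x0; rewrite lt0r; apply/andP; split; last first.
  by apply: sumr_ge0 => i _; rewrite -expr2 sqr_ge0.
apply: contra x0; rewrite psumr_eq0 => [/allP h|i _]; last first.
  by rewrite -expr2 sqr_ge0.
apply/eqP/rowP => i; rewrite mxE; apply/eqP.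
by have := h i (mem_index_enum _); rewrite /= mulf_eq0 orbb.
Qed.

End ToR.

Section Cones.
Context {R : realType} {n k : nat} (a : 'I_k -> 'rV[R]_n).

Definition in_cone (T : {set 'I_k}) (x : 'rV[R]_n) : Prop :=
  exists2 l : 'I_k -> R, forall i, 0 <= l i & x = \sum_(i in T) l i *: a i.

End Cones.

(** * Farkas' lemma *)

Section Farkas.
Context {R : realType} {n : nat}.

(* Bartl's induction: a witness x for the first functionals is normalised by
   <a_m, x> = 1 and used to project the remaining data along a_m. *)
Lemma farkas_seq (s : seq 'rV[R]_n) (b : 'rV[R]_n) :
  (forall x, (forall c, c \in s -> pairing c x <= 0) -> pairing b x <= 0) ->
  exists2 l : seq R, (size l = size s) /\ {in l, forall c, 0 <= c} &
    b = \sum_(i < size s) l`_i *: s`_i.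
Proof.
move: {2}(size s) (erefl (size s)) => m; elim: m s b => [|m IH] s b.
  move=> /size0nil -> hb; exists [::] => //; rewrite big_ord0.
  apply/eqP; apply: contraT => /pairing_gt0; rewrite ltNge.
  by rewrite hb // => c; rewrite in_nil.
case: s => // a s [sm] hb.
have [hs|/existsNP[x /not_implyP[sx /negP]]] := pselect (forall x,
    (forall c, c \in s -> pairing c x <= 0) -> pairing b x <= 0).
  have [l [sl l0] bE] := IH s b sm hs.
  exists (0 :: l) => [/=|]; last by rewrite big_ord_recl /= scale0r add0r.
  split; first by rewrite sl.
  by move=> c; rewrite inE => /orP[/eqP ->//|/l0].
rewrite -ltNge => bx.
have ax : 0 < pairing a x.
  rewrite ltNge; apply: contraTN bx => ax; rewrite -leNgt; apply: hb => c.
  by rewrite inE => /orP[/eqP ->//|/sx].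
wlog ax1 : x sx bx ax / pairing a x = 1.
  move=> /(_ ((pairing a x)^-1 *: x)); apply => [c cs|||].
  - by rewrite pairingZr mulr_ge0_le0 ?sx ?invr_ge0 ?ltW.
  - by rewrite pairingZr mulr_gt0 ?invr_gt0.
  - by rewrite pairingZr mulVf ?lt0r_neq0.
  - by rewrite pairingZr mulVf ?lt0r_neq0.
pose proj c := c - pairing c x *: a.
have projE c y : pairing (proj c) y = pairing c (y - pairing a y *: x).
  by rewrite /proj pairingBl pairingZl pairingDr pairingNr pairingZr mulrC.
have [||l [sl l0] bE] := IH [seq proj c | c <- s] (proj b).
- by rewrite size_map.
- move=> y hy; rewrite projE; apply: hb => c; rewrite inE => /orP[/eqP ->|cs].
    by rewrite pairingDr pairingNr pairingZr ax1 mulr1 subrr.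
  by rewrite -projE; apply: hy; apply: map_f.
rewrite size_map in sl bE.
(* Evaluation at [x], where [pairing a x = 1], forces this coefficient of [a]; it is nonnegative
   because [b] is positive at [x] and the members of [s] are not. *)
pose c0 := pairing b x - \sum_(i < size s) l`_i * pairing s`_i x.
exists (c0 :: l) => /=.
  split; first by rewrite sl.
  move=> c; rewrite inE => /orP[/eqP ->|/l0//].
  rewrite /c0 subr_ge0 (le_trans _ (ltW bx)) // sumr_le0 // => i _.
  rewrite mulr_ge0_le0 //; first by apply: l0; rewrite mem_nth // sl.
  by apply: sx; rewrite mem_nth.
rewrite big_ord_recl /= -[LHS](subrK (pairing b x *: a)) -/(proj b) bE.
rewrite /c0 scalerBl addrC -addrA; congr (_ + _).
rewrite scaler_suml -sumrN -big_split /=; apply: eq_bigr => i _.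
by rewrite (nth_map 0) // /proj scalerBr scalerA addrC.
Qed.

Lemma farkas k (a : 'I_k -> 'rV[R]_n) (T : {set 'I_k}) (b : 'rV[R]_n) :
  ~ in_cone a T b ->
  exists2 u, 0 < pairing b u & forall i, i \in T -> pairing (a i) u <= 0.
Proof.
move=> nb; apply: contrapT => h; apply: nb.
have [|l [sl l0] ->] := @farkas_seq [seq a i | i <- enum T] b.
  move=> x hx; rewrite leNgt; apply/negP => bx; apply: h; exists x => // i iT.
  by apply: hx; apply: map_f; rewrite mem_enum.
rewrite size_map in sl *.
(* Outside [T] the index is [size l], and the default value 0 of [nth] is a legitimate
   coefficient. *)
exists (fun i => l`_(index i (enum T))) => [i|].
  have [/l0//|h'] := boolP (l`_(index i (enum T)) \in l).
  rewrite nth_default // leqNgt; apply: contra h' => h'; exact: mem_nth.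
rewrite -[RHS]big_enum /=; case st: (size (enum T)) => [|t].
  by rewrite (size0nil st) big_ord0 big_nil.
have [i0 _] : exists i0 : 'I_k, True by case: (enum T) st => // i; exists i.
rewrite (big_nth i0) big_mkord st; apply: eq_bigr => i _.
by rewrite (nth_map i0) ?st // index_uniq ?enum_uniq // st.
Qed.

End Farkas.

Section Hull.
Context {R : realType} {n k : nat} (s : 'I_k -> 'rV[R]_n).

Lemma hull_vertex i : hull s (s i).
Proof.
exists (fun j => (j == i)%:R); split.
- by move=> j; case: eqP.
- by rewrite (bigD1 i) //= eqxx big1 ?addr0 // => j /negbTE ->.
- rewrite (bigD1 i) //= eqxx scale1r big1 ?addr0 // => j /negbTE ->.
  by rewrite scale0r.
Qed.

Lemma hull_convex x y t :
  hull s x -> hull s y -> 0 <= t -> t <= 1 -> hull s (x + t *: (y - x)).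
Proof.
move=> [l [l0 l1 ->]] [l' [l'0 l'1 ->]] t0 t1.
exists (fun i => l i + t * (l' i - l i)); split.
- move=> i; have := l0 i; have := l'0 i => h' h.
  have -> : l i + t * (l' i - l i) = (1 - t) * l i + t * l' i by ring.
  by rewrite addr_ge0 ?mulr_ge0 ?subr_ge0.
- by rewrite big_split /= -mulr_sumr sumrB l1 l'1 subrr mulr0 addr0.
- rewrite -sumrB scaler_sumr -big_split /=; apply: eq_bigr => i _.
  by rewrite -scalerBl scalerA -scalerDl.
Qed.

Lemma pairing_hull (l : 'I_k -> R) u c : \sum_i l i = 1 ->
  pairing (\sum_i l i *: s i) u - c = \sum_i l i * (pairing (s i) u - c).
Proof.
move=> l1; rewrite pairing_suml -[c in LHS]mul1r -l1 mulr_suml -sumrB.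
by apply: eq_bigr => i _; rewrite pairingZl mulrBr.
Qed.

Lemma hull_le u c x :
  (forall i, pairing (s i) u <= c) -> hull s x -> pairing x u <= c.
Proof.
move=> sc [l [l0 l1 ->]]; rewrite -subr_le0 pairing_hull // sumr_le0 // => i _.
by rewrite mulr_ge0_le0 ?subr_le0.
Qed.

Lemma sum1_neq0 (l : 'I_k -> R) : \sum_i l i = 1 -> exists i, l i != 0.
Proof.
move=> l1; apply: contrapT => h; have /eqP := l1.
rewrite big1 => [|i _]; first by rewrite eq_sym oner_eq0.
by apply/eqP; apply: contra_notT h; exists i.
Qed.

(** Complementary slackness: the terms [l i * (c - pairing (s i) u)] are nonnegative and their sum
    is at most 0. *)
Lemma hull_max u c (l : 'I_k -> R) :
    (forall i, pairing (s i) u <= c) -> (forall i, 0 <= l i) ->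
    \sum_i l i = 1 -> c <= pairing (\sum_i l i *: s i) u ->
  forall i, l i = 0 \/ pairing (s i) u = c.
Proof.
move=> sc l0 l1; rewrite -subr_ge0 pairing_hull // => h i.
have : \sum_i l i * (c - pairing (s i) u) == 0.
  rewrite eq_le sumr_ge0 ?andbT => [|j _]; last by rewrite mulr_ge0 ?subr_ge0.
  rewrite -oppr_ge0 -sumrN (le_trans h) // le_eqVlt; apply/orP; left; apply/eqP.
  by apply: eq_bigr => j _; rewrite -mulrN opprB.
rewrite psumr_eq0 => [/allP/(_ i (mem_index_enum _))|j _]; last first.
  by rewrite mulr_ge0 ?subr_ge0.
by rewrite /= mulf_eq0 subr_eq0 => /orP[] /eqP; [left|right].
Qed.

End Hull.

(** * Vertices of the hull of finitely many lattice points *)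

Section Vertices.
Context {R : realType} {n k : nat} (s : 'I_k -> 'rV[int]_n).
Local Notation P := (hull (fun i => toR R (s i))).

Lemma exposed_vertex p u : P (toR R p) ->
    (forall i, s i != p -> pairing (toR R (s i)) u < pairing (toR R p) u) ->
  vertex P p.
Proof.
move=> Pp up.
have le i : pairing (toR R (s i)) u <= pairing (toR R p) u.
  by have [->|/up/ltW] := eqVneq (s i) p.
split; first by exists (toR R p).
exists u; apply/seteqP; split=> [_ ->|x [[l [l0 l1 xE]] /(_ _ Pp)]].
  by split=> // y; exact: hull_le.
rewrite xE => h; have lp := hull_max le l0 l1 h.
rewrite /= -[RHS]scale1r -l1 scaler_suml; apply: eq_bigr => i _.
have [->|/up] := eqVneq (s i) p => //.
by case: (lp i) => [->|->]; rewrite ?scale0r ?ltxx.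
Qed.

Lemma vertex_exposed p : vertex P p ->
  exists2 i, p = s i & exists u : 'rV[R]_n,
    forall j, s j != p -> pairing (toR R (s j)) u < pairing (toR R p) u.
Proof.
move=> [_ [u pE]]; have : [set toR R p] (toR R p) by [].
rewrite pE => -[[l [l0 l1 xE]] up].
have le i : pairing (toR R (s i)) u <= pairing (toR R p) u.
  by apply: up; exact: hull_vertex.
have eqp i : pairing (toR R (s i)) u = pairing (toR R p) u -> s i = p.
  move=> h; apply: (@toR_inj R); change ([set toR R p] (toR R (s i))).
  rewrite pE; split=> [|y Py]; first exact: (hull_vertex (fun i => toR R (s i))).
  by rewrite h; exact: up.
have [i li] := sum1_neq0 l1.
exists i.
  have := hull_max le l0 l1; rewrite -xE => /(_ (lexx _) i) [/eqP|/eqp ->//].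
  by rewrite (negbTE li).
exists u => j jp; rewrite lt_neqAle le andbT.
by apply: contra jp => /eqP/eqp ->.
Qed.

(* For large N the functional N e1 + e2 exposes p. *)
Lemma lex_vertex p e1 e2 : P (toR R p) ->
    (forall i, pairing (toR R (s i)) e1 <= pairing (toR R p) e1) ->
    (forall i, pairing (toR R (s i)) e1 = pairing (toR R p) e1 ->
       s i != p -> pairing (toR R (s i)) e2 < pairing (toR R p) e2) ->
  vertex P p.
Proof.
move=> Pp h1 h2.
pose d e i := pairing (toR R p) e - pairing (toR R (s i)) e.
(* The sum dominates each quotient; where [d e1 i = 0] the quotient is 0 by convention and does no
   harm. *)
pose N := \sum_i (`|d e2 i| + 1) / d e1 i.
have d1 i : 0 <= d e1 i by rewrite subr_ge0.
apply: (@exposed_vertex p (N *: e1 + e2)) => // i ip.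
rewrite -subr_gt0 !pairingDr !pairingZr.
have -> : N * pairing (toR R p) e1 + pairing (toR R p) e2 -
  (N * pairing (toR R (s i)) e1 + pairing (toR R (s i)) e2) =
  N * d e1 i + d e2 i by rewrite /d; ring.
have [d0|d0] := eqVneq (d e1 i) 0.
  rewrite d0 mulr0 add0r subr_gt0 h2 //.
  by apply/eqP; rewrite eq_sym -subr_eq0 -/(d e1 i) d0.
have : `|d e2 i| + 1 <= N * d e1 i.
  rewrite -ler_pdivrMr ?lt0r ?d0 ?d1 // /N [leRHS](bigD1 i) //= lerDl.
  by apply: sumr_ge0 => j _; apply: divr_ge0 (d1 j); apply: addr_ge0; rewrite ?ler01 ?normr_ge0.
by have := ler_norm (- d e2 i); rewrite normrN; lra.
Qed.

(** A generator of largest Euclidean norm on the face is a vertex: among the generators on the face,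
    the functional given by that generator itself has its strict maximum there, by expanding the
    squared distance to any other one. *)
Lemma face_vertex F : face P F -> exists2 p, vertex P p & F (toR R p).
Proof.
move=> [[x Fx] [e FE]]; move: Fx; rewrite {1}FE => -[Px xe].
have [l [l0 l1 xE]] := Px.
have le i : pairing (toR R (s i)) e <= pairing x e.
  by apply: xe; exact: (hull_vertex (fun i => toR R (s i))).
have [i0 li] := sum1_neq0 l1.
have i0e : pairing (toR R (s i0)) e == pairing x e.
  have := hull_max le l0 l1; rewrite -xE => /(_ (lexx _) i0) [/eqP|->//].
  by rewrite (negbTE li).
pose Q i := pairing (toR R (s i)) e == pairing x e.
pose sq i := pairing (toR R (s i)) (toR R (s i)).
case: (@arg_maxP _ _ _ i0 Q sq i0e) => i /eqP Qi imax.
exists (s i); last first.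
  rewrite FE; split; first exact: (hull_vertex (fun i => toR R (s i))).
  by move=> y Py; rewrite Qi; exact: xe.
apply: (@lex_vertex _ e (toR R (s i))) => [|j|j].
- exact: (hull_vertex (fun i => toR R (s i))).
- by rewrite Qi; exact: le.
rewrite Qi => /eqP/imax; rewrite /sq => ji ne.
have : 0 < pairing (toR R (s j) - toR R (s i)) (toR R (s j) - toR R (s i)).
  by apply: pairing_gt0; rewrite subr_eq0 (inj_eq toR_inj).
rewrite !(pairingBl, pairingDr, pairingNr) (pairingC (toR R (s i)) (toR R (s j))).
by move: ji; rewrite /sq /=; lra.
Qed.

End Vertices.

(** * The edges at a vertex generate its cone *)

Section EdgeCone.
Context {R : realType} {n : nat}.

Lemma row_free1 (t : 'rV[R]_n) : t != 0 -> row_free t.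
Proof. by move=> t0; rewrite /row_free rank_rV t0. Qed.

Lemma segment_aff_dim (F : set 'rV[R]_n) x t : t != 0 -> F x -> F (x + t) ->
  (forall y, F y -> exists r, y - x = r *: t) -> aff_dim F 1.
Proof.
move=> t0 Fx Ft Fl; split.
  exists x, t; split=> // [i|]; last exact: row_free1.
  by rewrite ord1 row_id.
move=> [y [A [Fy FA Afree]]].
have A_sub i : (row i A <= t)%MS.
  have [r yE] := Fl _ Fy; have [r' ] := Fl _ (FA i).
  rewrite addrAC yE => /(canRL (addKr _)) ->.
  by rewrite -scaleNr -scalerDl scalemx_sub.
have : (A <= t)%MS by apply/row_subP.
by move/mxrankS; move: Afree; rewrite /row_free rank_rV t0 => /eqP ->.
Qed.

(** Descent on the sum of absolute values: a factorisation by a nonunit [d] has absolute value of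
    [d] at least 2, so the cofactor is smaller. *)
Lemma primitive_multiple (t : 'rV[int]_n) : t != 0 ->
  exists2 w, primitive w & exists2 c : int, 0 < c & t = c *: w.
Proof.
have [N] := ubnP (\sum_i absz (t 0%R i))%N; elim: N t => // N IH t tN t0.
have [|nt] := pselect (primitive t).
  by exists t => //; exists 1; rewrite ?scale1r.
move: nt => /existsNP[d /existsNP[w' /not_implyP[tE du]]].
have d0 : d != 0 by apply: contraNneq t0 => d0; rewrite tE d0 scale0r.
have w0 : w' != 0 by apply: contraNneq t0 => w0; rewrite tE w0 scaler0.
have d2 : (2 <= `|d|)%N.
  have d1 : d != 1 by apply/eqP => dE; apply: du; rewrite dE unitr1.
  have dN1 : d != -1 by apply/eqP => dE; apply: du; rewrite dE unitrN1.
  by lia.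
(* The sign of [d] is moved into the vector, so that the final multiple is positive. *)
pose w := (Num.sg d) *: w'.
have absw i : absz (w 0%R i) = absz (w' 0%R i).
  by rewrite mxE abszM absz_sg d0 mul1n.
have [||u pu [c c0 wE]] := IH w.
- apply: leq_trans (_ : \sum_i absz (t 0%R i) <= N)%N; last by [].
  rewrite (eq_bigr _ (fun i _ => absw i)).
  have lt0 : (0 < \sum_i absz (w' 0%R i))%N.
    rewrite lt0n sum_nat_eq0; apply: contra w0 => /forallP h.
    by apply/eqP/rowP => i; rewrite mxE; apply/eqP; rewrite -absz_eq0; exact: h.
  have -> : (\sum_i absz (t 0%R i) = `|d| * \sum_i absz (w' 0%R i))%N.
    by rewrite big_distrr; apply: eq_bigr => i _; rewrite tE mxE abszM.
  by rewrite -[ltnLHS]mul1n ltn_pmul2r.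
- apply: contra w0 => /eqP w0; apply/eqP/rowP => i.
  by apply/eqP; rewrite mxE -absz_eq0 -absw w0 mxE.
exists u => //; exists (`|d| * c); first by rewrite mulr_gt0 ?normr_gt0.
by rewrite -scalerA -wE /w scalerA mulrC mulr_sg_norm tE.
Qed.

Variables (k : nat) (s : 'I_k -> 'rV[int]_n).
Local Notation P := (hull (fun i => toR R (s i))).

(* A generator t in a minimal generating set of the cone at p spans an extreme
   ray: tilting a functional that separates t from the other generators by one
   that exposes p yields a functional that exposes the edge along t. *)
Lemma edge_cone p (u : 'rV[R]_n) : vertex P p ->
    (forall w, primitive_edge_vector P p w -> pairing (toR R w) u <= 0) ->
  forall y, P y -> pairing y u <= pairing (toR R p) u.
Proof.
move=> /vertex_exposed[ip pE [u0 u0p]] hu y.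
pose d i := toR R (s i) - toR R p.
pose gen (T : {set 'I_k}) := `[< forall i, in_cone d T (d i) >].
have Pp : P (toR R p) by rewrite pE; exact: (hull_vertex (fun i => toR R (s i))).
have genT : gen [set: 'I_k]%SET.
  apply/asboolP => i; exists (fun j => (j == i)%:R) => [j|]; first by case: eqP.
  rewrite (big_setD1 i) ?inE //= eqxx scale1r big1 ?addr0 // => j.
  by rewrite !inE => /andP[/negbTE -> _]; rewrite scale0r.
have [T /minsetP[/asboolP Tgen Tmin] _] := minset_exists genT.
suff dT t : t \in T -> pairing (d t) u <= 0.
  apply: hull_le => i; rewrite -subr_le0 -pairingBl -/(d i).
  have [l l0 ->] := Tgen i; rewrite pairing_suml sumr_le0 // => t tT.
  by rewrite pairingZl mulr_ge0_le0 ?dT.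
move=> tT.
have dtT : ~ in_cone d (T :\ t) (d t).
  move=> [l l0 dt]; have : t \notin T :\ t by rewrite !inE eqxx.
  rewrite (Tmin (T :\ t)) ?tT ?subD1set //; apply/asboolP => i.
  have [l' l'0 ->] := Tgen i; exists (fun j => l' j + l' t * l j) => [j|].
    by rewrite addr_ge0 ?mulr_ge0.
  rewrite (big_setD1 t) //= {1}dt scaler_sumr -big_split /=.
  by apply: eq_bigr => j _; rewrite scalerA addrC -scalerDl.
have dt0 : d t != 0.
  apply/negP => /eqP dt; apply: dtT; exists (fun=> 0) => //.
  by rewrite dt big1 // => i _; rewrite scale0r.
have stp i : d i != 0 -> s i != p.
  by apply: contra => /eqP ip'; rewrite /d ip' subrr.
have u0d i : d i != 0 -> pairing (d i) u0 < 0.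
  by move=> /stp/u0p; rewrite pairingBl subr_lt0.
have [u1 u1t u1T] := farkas dtT.
(* The quotient is negative, so [e] is [u1] plus a positive multiple of [u0]: it vanishes on [d t]
   and is negative on the other generators, where [u1] is at most 0 and [u0] is negative. *)
pose e := u1 - (pairing (d t) u1 / pairing (d t) u0) *: u0.
have dtu0 := u0d _ dt0.
have et : pairing (d t) e = 0.
  by rewrite pairingDr pairingNr pairingZr divfK ?subrr // lt_eqF.
have eT j : j \in T -> j != t -> pairing (d j) e < 0.
  move=> jT jt; have jTt : j \in T :\ t by rewrite !inE jt.
  have dj0 : d j != 0.
    apply/negP => /eqP dj; have : j \notin T :\ j by rewrite !inE eqxx.
    rewrite (Tmin (T :\ j)) ?jT ?subD1set //; apply/asboolP => i.
    have [l' l'0 ->] := Tgen i; exists l' => //.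
    by rewrite (big_setD1 j) //= dj scaler0 add0r.
  have := u1T _ jTt; have := u0d _ dj0.
  have : pairing (d t) u1 / pairing (d t) u0 < 0 by rewrite pmulr_rlt0 ?invr_lt0.
  by rewrite pairingDr pairingNr pairingZr; nra.
have ele x : P x -> pairing x e <= pairing (toR R p) e.
  apply: hull_le => i; rewrite -subr_le0 -pairingBl -/(d i).
  have [l l0 ->] := Tgen i; rewrite pairing_suml sumr_le0 // => j jT.
  rewrite pairingZl mulr_ge0_le0 //.
  by have [->|/(eT _ jT)/ltW//] := eqVneq j t; rewrite et.
pose E := [set x | P x /\ forall y, P y -> pairing y e <= pairing x e].
have EE x : P x -> pairing x e = pairing (toR R p) e -> E x.
  by move=> Px xe; split=> // z /ele; rewrite xe.
have Ept : E (toR R p + d t).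
  apply: EE; last by rewrite pairingDl et addr0.
  by rewrite /d subrKC; exact: (hull_vertex (fun i => toR R (s i))).
have Ep : E (toR R p) by exact: EE.
have Eedge : edge P E.
  split; first by split; [exists (toR R p)|exists e].
  apply: (segment_aff_dim dt0 Ep Ept) => x [Px /(_ _ Pp) xe].
  have [l [l0 l1 xE]] := Px.
  have lE : x - toR R p = \sum_i l i *: d i.
    rewrite xE -[toR R p]scale1r -l1 scaler_suml -sumrB.
    by apply: eq_bigr => i _; rewrite scalerBr.
  have le i : pairing (toR R (s i)) e <= pairing (toR R p) e.
    by apply: ele; exact: (hull_vertex (fun i => toR R (s i))).
  rewrite xE in xe; have lp := hull_max le l0 l1 xe.
  have lin i : exists r, l i *: d i = r *: d t.
    case: (lp i) => [->|]; first by exists 0; rewrite !scale0r.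
    move/eqP; rewrite -subr_eq0 -pairingBl -/(d i).
    have [l' l'0 ->] := Tgen i.
    rewrite pairing_suml => /eqP s0; exists (l i * l' t); rewrite -scalerA.
    rewrite (big_setD1 t) //= big1 ?addr0 // => j; rewrite !inE => /andP[jt jT].
    suff -> : l' j = 0 by rewrite scale0r.
    apply/eqP; apply: contraT => l'j.
    have := ltxx (0 : R); rewrite -[X in X < _]s0 (bigD1 j) //= pairingZl.
    move=> <-; rewrite ltr_nwDl //; first by rewrite pmulr_rlt0 ?lt0r ?l'j ?l'0 ?eT.
    rewrite sumr_le0 // => i0 /andP[i0T _]; rewrite pairingZl mulr_ge0_le0 //.
    by have [->|/(eT _ i0T)/ltW//] := eqVneq i0 t; rewrite et.
  exists (\sum_i sval (cid (lin i))); rewrite lE scaler_suml.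
  by apply: eq_bigr => i _; case: cid => r /= <-.
(* An edge vector must be primitive with [p + w] on the edge; this point divides the segment from
   [p] to [s t] in the ratio given by the integer [c >= 1], so convexity puts it in [P]. *)
have [|w wprim [c c0 tE]] := @primitive_multiple (s t - p).
  by rewrite subr_eq0 stp.
have dE : d t = c%:~R *: toR R w by rewrite -toRZ -tE toRB.
have cR : 0 < c%:~R :> R by rewrite ltr0z.
have c1 : 1 <= c%:~R :> R by rewrite ler1z; lia.
rewrite dE pairingZl pmulr_rle0 //; apply: hu; split=> //; exists E; split=> //.
rewrite toRD; have wE : toR R w = c%:~R^-1 *: (toR R p + d t - toR R p).
  by rewrite addrAC subrr add0r dE scalerA mulVf ?scale1r ?lt0r_neq0.
apply: EE.
  rewrite wE; apply: hull_convex => //; first by case: Ept.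
    by rewrite invr_ge0 ltW.
  by rewrite invf_le1.
by rewrite wE addrAC subrr add0r pairingDl pairingZl et mulr0 addr0.
Qed.

End EdgeCone.

Lemma dual_basis_sum (A : comPzRingType) n (U V : 'I_n -> 'rV[A]_n) m :
    (forall j k, \sum_i U i 0 j * V i 0 k = (j == k)%:R) ->
  m = \sum_i pairing m (U i) *: V i.
Proof.
move=> UV; apply/rowP => k; rewrite summxE.
under eq_bigr => i _ do rewrite mxE mulr_suml.
rewrite exchange_big (bigD1 k) //= [X in _ + X]big1 ?addr0 => [|j /negbTE jk].
  under eq_bigr => i _ do rewrite -mulrA.
  by rewrite -mulr_sumr UV eqxx mulr1.
under eq_bigr => i _ do rewrite -mulrA.
by rewrite -mulr_sumr UV jk mulr0.
Qed.

(** * Edge bases at the vertices of a smooth polytope *)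

Section SmoothPolytope.
Context {R : realType} {n : nat} (P : set 'rV[R]_n).
Hypothesis hP : smooth_full_dim_lattice_polytope P.

Definition vtx : Type := {p : 'rV[int]_n | vertex P p}.
Definition vpt (p : vtx) : 'rV[int]_n := sval p.
Implicit Types (p q : vtx) (m : 'rV[int]_n).

(** Smoothness only asserts that a basis exists; one is chosen per vertex, so equal indices at two
    vertices have nothing to do with each other. *)
Definition edge_mx p : 'M[int]_n :=
  sval (cid2 (let: And3 _ _ h := hP in h _ (svalP p))).

Lemma edge_mx_unit p : edge_mx p \in unitmx.
Proof. by rewrite /edge_mx; case: cid2. Qed.

Lemma edge_mx_primitive p w :
  primitive_edge_vector P (vpt p) w <-> exists i, w = row i (edge_mx p).
Proof.
rewrite /edge_mx; case: cid2 => B /= _ BE.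
change ([set w | primitive_edge_vector P (vpt p) w] w <-> exists i, w = row i B).
by rewrite BE; split=> [[i _ <-]|[i ->]]; exists i.
Qed.

(* Outer normal fan: the coordinates on U_p have weights b p i, the opposites
   of the primitive edge vectors at p. *)
Definition bvec p i : 'rV[int]_n := - row i (edge_mx p).
Definition uvec p i : 'rV[int]_n := - \row_j invmx (edge_mx p) j i.
(** The exponent of the [i]-th coordinate of [U_p] in [chi^m]. At [vpt p - m] it is the lattice
    distance of [m] from the facet at [p] spanned by the other edges. *)
Definition acoef p i m : int := pairing m (uvec p i).

Lemma bvec_dual p i j : pairing (bvec p j) (uvec p i) = (i == j)%:R.
Proof.
rewrite pairingNl pairingNr opprK.
have /matrixP/(_ j i) := mulmxV (edge_mx_unit p); rewrite !mxE eq_sym => <-.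
by apply: eq_bigr => k _; rewrite !mxE.
Qed.

Lemma uvec_dual p j k : \sum_i uvec p i 0 j * bvec p i 0 k = (j == k)%:R.
Proof.
have /matrixP/(_ j k) := mulVmx (edge_mx_unit p); rewrite !mxE => <-.
by apply: eq_bigr => i _; rewrite !mxE mulrNN.
Qed.

Lemma bvec_sum p m : m = \sum_i acoef p i m *: bvec p i.
Proof. exact: dual_basis_sum (uvec_dual p). Qed.

Lemma bvec_sumR p (y : 'rV[R]_n) :
  y = \sum_i pairing y (toR R (uvec p i)) *: toR R (bvec p i).
Proof.
apply: dual_basis_sum => j k.
have -> : (j == k)%:R = ((j == k)%:R : int)%:~R :> R by case: eqP.
rewrite -(uvec_dual p) rmorph_sum.
by apply: eq_bigr => i _; rewrite !mxE rmorphM.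
Qed.

Lemma acoefB p i m m' : acoef p i (m - m') = acoef p i m - acoef p i m'.
Proof. exact: pairingBl. Qed.

Lemma acoefD p i m m' : acoef p i (m + m') = acoef p i m + acoef p i m'.
Proof. exact: pairingDl. Qed.

Lemma acoef0 p i : acoef p i 0 = 0.
Proof. exact: pairing0l. Qed.

Lemma acoef_bvec p i j : acoef p i (bvec p j) = (i == j)%:R.
Proof. exact: bvec_dual. Qed.

Lemma pairing_bvec p m w :
  pairing m w = \sum_i acoef p i m * pairing (bvec p i) w.
Proof.
rewrite {1}(bvec_sum p m) pairing_suml.
by apply: eq_bigr => i _; rewrite pairingZl.
Qed.

Definition lat : set 'rV[int]_n := [set m | P (toR R m)].

Lemma lat_vtx p : lat (vpt p).
Proof.
have [_ [u pE]] := svalP p; rewrite /lat /=.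
have : [set toR R (sval p)] (toR R (sval p)) by [].
by rewrite /vpt pE => -[].
Qed.

Lemma lat_edge p i : lat (vpt p - bvec p i).
Proof.
rewrite opprK; have : primitive_edge_vector P (vpt p) (row i (edge_mx p)).
  by apply/edge_mx_primitive; exists i.
by move=> [_ [E [[[_ [u ->]] _] _ []]]].
Qed.

(** By smoothness the rows of [edge_mx p] are all the primitive edge vectors, so [edge_cone]
    applies. This places [P] in the simplicial cone at [p] and makes all facet distances
    nonnegative. *)
Lemma vertex_cone p (u : 'rV[R]_n) :
    (forall i, 0 <= pairing (toR R (bvec p i)) u) ->
  forall y, P y -> pairing y u <= pairing (toR R (vpt p)) u.
Proof.
move=> bu; case: (hP) => -[k [s PE]] _ _.
have := edge_mx_primitive p; have : vertex P (vpt p) := svalP p.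
move: bu; rewrite /bvec; move: (vpt p) (edge_mx p) => x B; rewrite PE => Bu xP xB.
apply: edge_cone => // w /xB[i ->].
have := Bu i; rewrite -[- row _ _]scaleN1r.
by rewrite toRZ pairingZl mulrN1z mulN1r oppr_ge0.
Qed.

Lemma acoefR p i m : pairing (toR R m) (toR R (uvec p i)) = (acoef p i m)%:~R.
Proof. exact: pairing_toR. Qed.

Lemma acoefR_ge0 p i y :
  P y -> 0 <= pairing (toR R (vpt p) - y) (toR R (uvec p i)).
Proof.
rewrite pairingBl subr_ge0; apply: vertex_cone => j.
by rewrite acoefR acoef_bvec; case: eqP.
Qed.

Lemma acoef_ge0 p i m : lat m -> 0 <= acoef p i (vpt p - m).
Proof. by move=> /(acoefR_ge0 p i); rewrite -toRB acoefR ler0z. Qed.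

Lemma vtx_face F : face P F -> exists p : vtx, F (toR R (vpt p)).
Proof.
case: (hP) => -[k [s PE]] _ _ FF; have := FF; rewrite PE => /face_vertex[p].
by rewrite -PE => pP Fp; exists (exist _ p pP).
Qed.

Lemma vtx_inh : inhabited vtx.
Proof.
case: (hP) => _ [[x0 [A [Px _ _]]] _] _.
have [|p _] := @vtx_face P; last by [].
split; first by exists x0.
exists 0; apply/seteqP; split=> [x Px'|x []] //.
by split=> // y _; rewrite !pairing0r.
Qed.

Lemma vtx_max v (Q : vtx -> Prop) : (exists q, Q q) ->
  exists2 q, Q q & forall q', Q q' -> pairing (vpt q') v <= pairing (vpt q) v.
Proof.
case: (hP) => -[k [s PE]] _ _ [q Qq].
have idx q' : exists i, s i = vpt q'.
  have : vertex P (vpt q') := svalP q'; move: (vpt q') => x.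
  by rewrite PE => /vertex_exposed[i -> _]; exists i.
pose QQ i := `[< exists2 q', Q q' & s i = vpt q' >].
have [i0 i0E] := idx q.
have Qi0 : QQ i0 by apply/asboolP; exists q.
case: (@arg_maxP _ _ _ i0 QQ (fun i => pairing (s i) v) Qi0).
move=> i /asboolP[r Qr ri] imax; exists r => // q' Qq'.
have [j jE] := idx q'.
have := imax j; rewrite /= ri jE; apply.
by apply/asboolP; exists q'.
Qed.

(** The other end of an edge is the farthest generator of [P] on the ray from [q] along it. *)
Lemma next_vtx q i : exists q', exists2 l : int,
  0 < l & vpt q' = vpt q - l *: bvec q i.
Proof.
have PE := hP; case: PE => -[k [s PE]] _ _.
have latE j : lat (s j).
  by rewrite /lat PE; exact: (hull_vertex (fun i => toR R (s i))).
pose ray j := [forall k, (k != i) ==> (acoef q k (vpt q - s j) == 0)].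
have rayE j : ray j -> s j = vpt q - acoef q i (vpt q - s j) *: bvec q i.
  move=> /forallP rj; apply/eqP; rewrite eq_sym subr_eq addrC -subr_eq.
  apply/eqP; rewrite {1}(bvec_sum q (vpt q - s j)) (bigD1 i) //= big1 ?addr0 //.
  by move=> j' /(implyP (rj j'))/eqP ->; rewrite scale0r.
(* The neighbour [vpt q - bvec q i] is a convex combination of generators. Its distances to the
   facets other than [i] are 0 and are weighted sums of nonnegative distances, so every generator of
   positive weight lies on the ray. *)
have [j0 rj0 lj0] : exists2 j, ray j & 0 < acoef q i (vpt q - s j).
  have := lat_edge q i; rewrite /lat PE => -[l [l0 l1 xE]].
  have aE k' : (k' == i)%:R =
      \sum_j l j * pairing (toR R (vpt q - s j)) (toR R (uvec q k')).
    have : pairing (toR R (vpt q - (vpt q - bvec q i))) (toR R (uvec q k')) = (k' == i)%:R.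
      by rewrite subKr acoefR acoef_bvec; case: eqP.
    move=> <-; rewrite toRB xE -[toR R (vpt q) in LHS]scale1r -l1 scaler_suml -sumrB.
    rewrite pairing_suml; apply: eq_bigr => j _.
    by rewrite -scalerBr -toRB pairingZl.
  have [j lj] : exists j, l j * pairing (toR R (vpt q - s j)) (toR R (uvec q i)) != 0.
    apply: contrapT => h; have /eqP := aE i; rewrite eqxx big1 ?oner_eq0 // => j _.
    by apply/eqP; apply: contra_notT h; exists j.
  move: lj; rewrite mulf_eq0 acoefR intr_eq0 negb_or => /andP[lj aj].
  exists j; last by rewrite lt0r aj acoef_ge0.
  apply/forallP => k'; apply/implyP => /negbTE k'i.
  have /eqP := aE k'; rewrite k'i eq_sym psumr_eq0 => [|j' _]; last first.
    by rewrite mulr_ge0 // acoefR ler0z acoef_ge0.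
  move=> /allP/(_ j (mem_index_enum _)).
  by rewrite /= mulf_eq0 (negbTE lj) acoefR intr_eq0.
case: (@arg_maxP _ _ _ j0 ray (fun j => acoef q i (vpt q - s j)) rj0) => j rj jmax.
have sjP : vertex P (s j).
  (* The sum of the other [uvec q k] is maximal exactly on the ray, where [- uvec q i] then selects
     the farthest generator. *)
  rewrite PE; apply: (@lex_vertex _ _ _ _ _
    (\sum_(k | k != i) toR R (uvec q k)) (- toR R (uvec q i))).
  - by rewrite -PE; exact: latE.
  - move=> j'; rewrite ![pairing _ (\sum_(_ | _) _)]pairingC !pairing_suml.
    apply: ler_sum => k' k'i; rewrite ![pairing (toR R (uvec _ _)) _]pairingC.
    rewrite !acoefR ler_int; have := acoef_ge0 q k' (latE j'); rewrite acoefB.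
    have /eqP := implyP (forallP rj k') k'i; rewrite acoefB => /eqP.
    by rewrite subr_eq0 => /eqP ->; rewrite subr_ge0.
  move=> j' /eqP.
  rewrite -subr_eq0 -opprB -pairingBl oppr_eq0 pairingC pairing_suml.
  have sE k' : k' != i -> acoef q k' (s j) = acoef q k' (vpt q).
    by move=> /(implyP (forallP rj k')); rewrite acoefB subr_eq0 => /eqP.
  rewrite psumr_eq0 => [/allP h jj'|k' k'i]; last first.
    rewrite pairingC -toRB acoefR ler0z acoefB sE // -acoefB.
    exact: acoef_ge0.
  have rj' : ray j'.
    apply/forallP => k'; apply/implyP => k'i.
    have := h k' (mem_index_enum _).
    by rewrite k'i /= pairingC -toRB acoefR intr_eq0 !acoefB sE.
  rewrite !pairingNr ltrN2 !acoefR ltr_int lt_neqAle.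
  have := jmax _ rj'; rewrite /= !acoefB => jj; apply/andP; split; last by lia.
  apply: contra jj' => /eqP aa; rewrite (rayE _ rj) (rayE _ rj').
  by rewrite !acoefB aa.
exists (exist _ (s j) sjP), (acoef q i (vpt q - s j)); last exact: rayE.
by apply: lt_le_trans lj0 _; exact: jmax.
Qed.

End SmoothPolytope.

(** * Faces and the combinatorics of the flow *)

Section Faces.
Context {R : realType} {n : nat} {P : set 'rV[R]_n}.
Hypothesis hP : smooth_full_dim_lattice_polytope P.
Local Notation b := (bvec hP).
Local Notation u := (uvec hP).
Local Notation a := (acoef hP).
Implicit Types (p q : vtx P) (m : 'rV[int]_n) (I J : set 'I_n).

Lemma vpt_inj : injective (vpt (P := P)).
Proof.
move=> [p Pp] [q Pq]; rewrite /vpt /= => pq; case: q / pq Pq => Pq.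
by congr exist; exact: Prop_irrelevance.
Qed.

(* lattice points of the face of P at p spanned by the edges in I *)
Definition fset_at p I : set 'rV[int]_n :=
  [set m | lat P m /\ forall i, ~ I i -> a p i (vpt p - m) = 0].

Lemma fset_vtx p I : fset_at p I (vpt p).
Proof. by split=> [|i _]; [exact: lat_vtx|rewrite subrr acoef0]. Qed.

Lemma fset_edge p I i : fset_at p I (vpt p - b p i) <-> I i.
Proof.
split=> [[_ /(_ i)]|Ii].
  by rewrite subKr acoef_bvec eqxx => h; apply: contrapT => /h.
split=> [|j nIj]; first exact: lat_edge.
rewrite subKr acoef_bvec; case: eqP => // ji; by rewrite ji in nIj.
Qed.

Lemma fset_sub p I J : I `<=` J -> fset_at p I `<=` fset_at p J.
Proof. by move=> IJ m [Pm h]; split=> // i nJ; apply: h => /IJ. Qed.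

Lemma fset_setI p I J : fset_at p I `&` fset_at p J = fset_at p (I `&` J).
Proof.
apply/seteqP; split=> [m [[Pm h] [_ h']]|m fm].
  split=> // i nij; have [Ii|/h//] := pselect (I i).
  by apply: h' => Ji; apply: nij.
by split; apply: fset_sub fm => i [].
Qed.

Lemma fset_setT p : fset_at p setT = lat P.
Proof. by apply/seteqP; split=> [m []//|m Pm]; split=> // i []. Qed.

(** When the facet [k] at [p] contains [q], the left side is the distance of a neighbour of [q] from
    it; this is how [a p k (b q j)] is seen to be nonnegative. *)
Lemma acoef_bvec_ge0 p q k j :
  a p k (vpt p - vpt q) = 0 -> a p k (vpt p - (vpt q - b q j)) = a p k (b q j).
Proof. by move=> h; rewrite opprB addrCA acoefD h addr0. Qed.

Lemma acoef_sum p q k m : a p k (vpt p - vpt q) = 0 ->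
  a p k (vpt p - m) = \sum_j a q j (vpt q - m) * a p k (b q j).
Proof.
move=> h; rewrite -[vpt p - m](subrKA (vpt q)) acoefD h add0r.
exact: pairing_bvec.
Qed.

(** For [k] outside [I] the facet [k] at [p] contains [q], and the distance of [m] from it is the
    sum of the products [a q j (vpt q - m) * a p k (b q j)], all nonnegative. If it vanishes, it
    does so termwise, so [m] uses only edges at [q] whose neighbours stay in the face. *)
Lemma fset_rebase p q I : fset_at p I (vpt q) ->
  fset_at p I = fset_at q [set i | fset_at p I (vpt q - b q i)].
Proof.
move=> [_ hq]; apply/seteqP; split=> m [Pm hm]; split=> // i.
  move=> ni; apply/eqP; apply: contra_notT ni => ai.
  split=> [|k nk]; first exact: lat_edge.
  have /eqP := hm k nk; rewrite (acoef_sum _ (hq k nk)) psumr_eq0 => [|j _].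
    move=> /allP/(_ i (mem_index_enum _)); rewrite /= mulf_eq0 (negbTE ai) /=.
    by move/eqP <-; rewrite acoef_bvec_ge0 // hq.
  rewrite mulr_ge0 ?acoef_ge0 // -acoef_bvec_ge0 ?hq // acoef_ge0 //.
  exact: lat_edge.
move=> ni; rewrite (acoef_sum _ (hq i ni)) big1 // => j _.
have [[_ /(_ i ni) h]|/hm ->] := pselect (fset_at p I (vpt q - b q j)).
  by rewrite -acoef_bvec_ge0 ?hq // h mulr0.
by rewrite mul0r.
Qed.

Lemma next_fset q I i : I i -> exists2 q' : vtx P, fset_at q I (vpt q') &
  exists2 l : int, 0 < l & vpt q' = vpt q - l *: b q i.
Proof.
move=> Ii; have [q' [l l0 q'E]] := next_vtx hP q i.
exists q'; last by exists l.
split=> [|j nj]; first exact: lat_vtx.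
rewrite q'E subKr /acoef pairingZl -/(acoef hP q j (b q i)) acoef_bvec.
by case: eqP nj => [->//|]; rewrite mulr0.
Qed.

(** The outer normal cone of the face at [p] spanned by the edges in [J]; [J = set0] gives the
    maximal cone of the vertex. *)
Definition cone p J : set 'rV[R]_n :=
  [set w | (forall i, 0 <= pairing (toR R (b p i)) w) /\
           forall i, J i -> pairing (toR R (b p i)) w = 0].

Lemma normal_cone_cone s : outer_normal_fan P s -> exists p J, s = cone p J.
Proof.
move=> [F FF ->]; have [p Fp] := vtx_face hP FF.
have [_ [e FE]] := FF.
exists p, [set i | F (toR R (vpt p - b p i))]; apply/seteqP; split=> w hw.
  have hb i : pairing (toR R (b p i)) w =
      pairing (toR R (vpt p)) w - pairing (toR R (vpt p - b p i)) w.
    by rewrite toRB pairingBl subKr.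
  split=> i; rewrite hb.
    by rewrite subr_ge0; apply: hw => //; exact: lat_edge.
  move=> Fi; apply/eqP; rewrite eq_le subr_ge0 subr_le0 !hw //.
    exact: lat_edge.
  exact: lat_vtx.
move=> x y Fx Py; apply: (le_trans (vertex_cone hw.1 Py)).
rewrite -subr_le0 -pairingBl (bvec_sumR hP p (toR R (vpt p) - x)) pairing_suml.
apply: sumr_le0 => i _; rewrite pairingZl.
have [Fi|nFi] := pselect (F (toR R (vpt p - b p i))).
  by rewrite hw.2 ?mulr0.
suff -> : pairing (toR R (vpt p) - x) (toR R (u p i)) = 0 by rewrite mul0r.
move: Fx Fp nFi; rewrite FE => -[Px xe] [Pp pe] nFi.
have be j : 0 <= pairing (toR R (b p j)) e.
  rewrite -[b p j](subKr (vpt p)) toRB pairingBl subr_ge0; apply: pe.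
  exact: lat_edge.
(* Both [p] and [x] lie in the face exposed by [e]. Expanded in the edges at [p] this zero has
   nonnegative terms, so the coordinate of an edge leaving [F] vanishes. *)
have : pairing (toR R (vpt p) - x) e = 0.
  by apply/eqP; rewrite pairingBl subr_eq0 eq_le xe // pe.
rewrite {1}(bvec_sumR hP p (toR R (vpt p) - x)) pairing_suml => /eqP.
rewrite psumr_eq0 => [/allP/(_ i (mem_index_enum _))|j _]; last first.
  by rewrite pairingZl mulr_ge0 // acoefR_ge0.
rewrite /= pairingZl mulf_eq0 => /orP[/eqP //|/eqP bi0].
exfalso; apply: nFi; split=> [|y' Py']; first exact: lat_edge.
by rewrite toRB pairingBl bi0 subr0; exact: pe.
Qed.

Lemma vertex_cone_fan p : outer_normal_fan P (cone p set0).
Proof.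
exists [set toR R (vpt p)]; first exact: (svalP p).
apply/seteqP; split=> w.
  by move=> [bw _] _ y -> Py; exact: (vertex_cone bw Py).
move=> hw; split=> // i.
rewrite -[b p i](subKr (vpt p)) toRB pairingBl subr_ge0; apply: hw => //.
exact: lat_edge.
Qed.

Lemma cone_uvec p J i : cone p J (toR R (u p i)) <-> ~ J i.
Proof.
split=> [[_ /(_ i)]|nJ].
  by rewrite acoefR acoef_bvec eqxx => h /h/eqP; rewrite oner_eq0.
split=> j; rewrite acoefR acoef_bvec; first by case: eqP.
by case: eqP => // ij Jj; case: nJ; rewrite ij.
Qed.

(** So the chart of [cone p J] is affine space with the coordinates in [J] inverted. *)
Lemma dual_cone p J m : dual_monoid (cone p J) m <-> forall i, ~ J i -> 0 <= a p i m.
Proof.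
split=> [hm i /cone_uvec/hm|hm w [bw Jw]]; first by rewrite acoefR ler0z.
rewrite [m](bvec_sum hP p); have -> : toR R (\sum_i a p i m *: b p i) =
    \sum_i (a p i m)%:~R *: toR R (b p i).
  rewrite /toR raddf_sum; apply: eq_bigr => i _; exact: toRZ.
rewrite pairing_suml sumr_ge0 // => i _; rewrite pairingZl.
have [Ji|nJi] := pselect (J i); first by rewrite Jw ?mulr0.
by rewrite mulr_ge0 // ler0z hm.
Qed.

(** * Flow sets of an admissible cocharacter *)

Section Cocharacter.
Variable v : 'rV[int]_n.
Hypothesis v_edge : forall p i, pairing (b p i) v != 0.

(* lattice points of the face whose orbits flow to the fixed point of p *)
Definition flow p : set 'rV[int]_n :=
  fset_at p [set i | 0 < pairing (b p i) v].

Lemma flow_le p m : flow p m -> pairing m v <= pairing (vpt p) v.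
Proof.
move=> [Pm hm]; rewrite -subr_ge0 -pairingBl (pairing_bvec hP p).
apply: sumr_ge0 => i _.
have [h|h] := ltP 0 (pairing (b p i) v).
  by rewrite mulr_ge0 ?acoef_ge0 // ltW.
by rewrite hm ?mul0r //= ; apply/negP; rewrite -leNgt.
Qed.

Lemma flow_lt p m : flow p m -> m != vpt p -> pairing m v < pairing (vpt p) v.
Proof.
move=> fm mp; rewrite lt_neqAle flow_le // andbT; apply: contra mp => /eqP mv.
have [Pm hm] := fm.
have /eqP : pairing (vpt p - m) v = 0 by rewrite pairingBl mv subrr.
have ge0 i : 0 <= a p i (vpt p - m) * pairing (b p i) v.
  have [h|h] := ltP 0 (pairing (b p i) v).
    by rewrite mulr_ge0 ?acoef_ge0 // ltW.
  by rewrite hm ?mul0r //= ; apply/negP; rewrite -leNgt.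
rewrite (pairing_bvec hP p) psumr_eq0 // => /allP h.
rewrite eq_sym -subr_eq0 (bvec_sum hP p (vpt p - m)) big1 // => i _.
have := h i (mem_index_enum _).
by rewrite /= mulf_eq0 (negbTE (v_edge _ _)) orbF => /eqP ->; rewrite scale0r.
Qed.

(** At the vertex of the face with largest [v] every edge of the face goes down, as [next_fset]
    would follow an up edge to a higher vertex. This is why the cells cover. *)
Lemma max_flow p I : exists2 q, fset_at p I (vpt q) & fset_at p I `<=` flow q.
Proof.
have [|q Iq qmax] := @vtx_max _ _ _ hP v (fun q => fset_at p I (vpt q)).
  by exists p; exact: fset_vtx.
exists q => //; move: qmax; rewrite (fset_rebase Iq).
set J := [set i | _] => qmax; apply: fset_sub => i Ji /=.
rewrite ltNge; apply/negP => bi.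
have [q' Jq' [l l0 q'E]] := next_fset q Ji.
have := qmax _ Jq'; rewrite q'E pairingBl pairingZl gerBl.
by apply/negP; rewrite -ltNge nmulr_llt0 // lt_neqAle v_edge.
Qed.

(* v stratifies the subvariety of the face A, in terms of lattice points *)
Definition flow_closed (A : set 'rV[int]_n) : Prop :=
  forall p q, A (vpt p) -> A (vpt q) -> flow p (vpt q) ->
    flow q `&` A `<=` flow p.

Lemma flow_closed_2faces :
    (forall q i j, i != j -> flow_closed (fset_at q [set k | k = i \/ k = j])) ->
  forall p q, flow p (vpt q) -> flow q `<=` flow p.
Proof.
move=> h2 p q0 hq0; apply: contrapT => nq0.
(* The downward induction is run as a counterexample [q] with largest [v]. *)
have [|q [fq nq] qmax] := @vtx_max _ _ _ hP v
    (fun q => flow p (vpt q) /\ ~ (flow q `<=` flow p)); first by exists q0.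
apply: nq; have [qp|qp] := eqVneq (vpt q) (vpt p); first by rewrite (vpt_inj qp).
pose J := [set i | flow p (vpt q - b q i)].
have pJ : flow p = fset_at q J by exact: fset_rebase.
(* [p] lies strictly above [q], and both lie in the face [flow p], so the expansion of
   [vpt q - vpt p] in the edges of this face at [q] must use one along which [v] increases. *)
have [i Ji bi] : exists2 i, J i & pairing (b q i) v < 0.
  apply: contrapT => h; have := flow_lt fq qp.
  rewrite -subr_lt0 -pairingBl (pairing_bvec hP q) ltNge; apply/negP/negPn.
  have [_ aJ] : fset_at q J (vpt p) by rewrite -pJ; exact: fset_vtx.
  apply: sumr_ge0 => i _; have [Ji|/aJ ->] := pselect (J i); last by rewrite mul0r.
  rewrite mulr_ge0 ?acoef_ge0 //; first exact: lat_vtx.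
  by rewrite leNgt; apply/negP => bi; apply: h; exists i.
have [q' iq' q'i] := max_flow q [set k | k = i].
have pq' : flow p (vpt q') by rewrite pJ; apply: fset_sub iq' => k ->.
have q'p : flow q' `<=` flow p.
  apply: contrapT => nq'; have := qmax q' (conj pq' nq').
  apply/negP; rewrite -ltNge.
  have : flow q' (vpt q - b q i) by apply: q'i; apply/fset_edge.
  move=> /flow_le; apply: lt_le_trans.
  by rewrite pairingBl ltrBrDr gtrDl.
rewrite pJ; apply: fset_sub => j /= bj.
have ij : i != j by apply: contraTneq bj => <-; rewrite -leNgt ltW.
apply: q'p; apply: (h2 q i j ij q' q) => //.
- by apply: fset_sub iq' => k ->; left.
- exact: fset_vtx.
- by apply: q'i; exact: fset_vtx.
- by split; apply/fset_edge => //; right.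
Qed.

End Cocharacter.

End Faces.

(** * Points and homogeneous coordinates *)

Section Charts.
Context {R : realType} {n : nat} {K : fieldType}.
Implicit Types (s : set 'rV[R]_n) (g d : 'rV[int]_n -> K) (m : 'rV[int]_n).

Lemma chart_sum s g (I : finType) (F : I -> 'rV[int]_n) : chart s g ->
  (forall i, dual_monoid s (F i)) -> g (\sum_i F i) = \prod_i g (F i).
Proof.
move=> [g0 gM] sF.
suff [] : dual_monoid s (\sum_i F i) /\ g (\sum_i F i) = \prod_i g (F i) by [].
elim/big_rec2: _ => [|i x y _ [sy <-]]; first by split=> //; exact: dual_monoid0.
by split; [exact: dual_monoidD|exact: gM].
Qed.

Lemma dual_monoidZ s m (k : nat) : dual_monoid s m -> dual_monoid s (k%:Z *: m).
Proof.
by move=> sm w sw; rewrite toRZ pairingZl mulr_ge0 ?sm ?ler0z.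
Qed.

Lemma chart_scale s g m (k : nat) : chart s g -> dual_monoid s m ->
  g (k%:Z *: m) = g m ^+ k.
Proof.
move=> [g0 gM] sm; elim: k => [|k IH]; first by rewrite scale0r g0.
rewrite intS scalerDl scale1r gM //; last exact: dual_monoidZ.
by rewrite IH exprS.
Qed.

Lemma chart_opp s g m : chart s g -> dual_monoid s m -> dual_monoid s (- m) ->
  g m * g (- m) = 1.
Proof. by move=> [g0 gM] sm smN; rewrite -gM // subrr g0. Qed.

Lemma dual_monoidS s s' m : s `<=` s' -> dual_monoid s' m -> dual_monoid s m.
Proof. by move=> ss sm w /ss; exact: sm. Qed.

End Charts.

Section Points.
Context {R : realType} {n : nat} {P : set 'rV[R]_n}.
Hypothesis hP : smooth_full_dim_lattice_polytope P.
Context (K : fieldType).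
Local Notation b := (bvec hP).
Local Notation u := (uvec hP).
Local Notation a := (acoef hP).
Local Notation cone := (cone hP).
Local Notation Sigma := (outer_normal_fan P).
Local Notation X := (toric_variety K Sigma).
Local Notation glue := (@Defs.glue R n K Sigma).
Local Notation is_chart_point := (@Defs.is_chart_point R n K Sigma).
Implicit Types (p q r : vtx P) (m : 'rV[int]_n) (J : set 'I_n).
Implicit Types (c : 'I_n -> K) (g : 'rV[int]_n -> K) (x y : X).

(* chi^m at the point of U_p with coordinates c; the value is junk when some
   c i = 0 has a negative exponent, as then c i ^ _ = 0. *)
Definition monz p c m : K := \prod_i c i ^ a p i m.

Lemma monz0 p c : monz p c 0 = 1.
Proof. by rewrite /monz big1 // => i _; rewrite acoef0 expr0z. Qed.

Lemma monz_bvec p c i : monz p c (b p i) = c i.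
Proof.
rewrite /monz (bigD1 i) //= acoef_bvec eqxx expr1z big1 ?mulr1 // => j ji.
by rewrite acoef_bvec (negbTE ji) expr0z.
Qed.

Lemma monzD p c m m' :
    (forall i, c i = 0 -> 0 <= a p i m /\ 0 <= a p i m') ->
  monz p c (m + m') = monz p c m * monz p c m'.
Proof.
move=> h; rewrite /monz -big_split; apply: eq_bigr => i _ /=.
rewrite acoefD; have [/h[]|] := eqVneq (c i) 0; last exact: expfzDr.
case: (a p i m) => // k _; case: (a p i m') => // k' _.
by rewrite -PoszD -!exprnP exprD.
Qed.

Lemma monz_neq0 p c m :
  monz p c m <> 0 <-> forall i, c i = 0 -> a p i m = 0.
Proof.
split=> [/eqP/prodf_neq0 h i ci|h].
  by apply/eqP; have := h i isT; rewrite expfz_eq0 ci eqxx andbT negbK.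
apply/eqP/prodf_neq0 => i _; rewrite expfz_eq0 negb_and negbK.
by have [/h ->|_] := eqVneq (c i) 0; rewrite ?eqxx ?orbT.
Qed.

Lemma chart_monz p c s :
  (forall i, c i = 0 -> s (toR R (u p i))) -> chart s (monz p c).
Proof.
move=> h; split=> [|m m' sm sm']; first exact: monz0.
apply: monzD => i /h si; have := sm _ si; have := sm' _ si.
by rewrite !acoefR !ler0z.
Qed.

Lemma chart_monz_vtx p c : chart (cone p set0) (monz p c).
Proof. by apply: chart_monz => i _; apply/cone_uvec. Qed.

Lemma cone_sub p J : cone p J `<=` cone p set0.
Proof. by move=> w [bw _]; split. Qed.

Lemma dual_vtx p J m : lat P m -> dual_monoid (cone p J) (vpt p - m).
Proof. by move=> Pm; apply/dual_cone => i _; exact: acoef_ge0. Qed.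

Lemma dual_bvec p J i : dual_monoid (cone p J) (b p i).
Proof. by apply/dual_cone => j _; rewrite acoef_bvec; case: eqP. Qed.

Arguments dual_vtx p J [m] Pm : rename.
Arguments dual_bvec : clear implicits.

Lemma dual_bvecN p J i : J i -> dual_monoid (cone p J) (- b p i).
Proof.
move=> Ji; apply/dual_cone => j nJj.
rewrite /acoef pairingNl -/(a p j (b p i)) acoef_bvec.
by case: eqP => // ji; case: nJj; rewrite ji.
Qed.

Arguments dual_bvecN p [J i] Ji.

(** The [b p i] generate the monoid once the inverses of those with [i] in [J] are added, and [g]
    takes nonzero values on the latter. *)
Lemma chart_monzE p J g m : chart (cone p J) g -> dual_monoid (cone p J) m ->
  g m = monz p (fun i => g (b p i)) m.
Proof.
move=> gc sm; have am i := (dual_cone hP p J m).1 sm i.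
have term i : dual_monoid (cone p J) (a p i m *: b p i) /\
    g (a p i m *: b p i) = g (b p i) ^ a p i m.
  have sb := dual_bvec p J i.
  case E: (a p i m) (am i) => [k|k] ami.
    by split; [exact: dual_monoidZ|exact: chart_scale gc sb].
  have [Ji|/ami//] := pselect (J i).
  have sbN := dual_bvecN p Ji.
  rewrite NegzE scaleNr -scalerN; split; first exact: dual_monoidZ.
  rewrite (chart_scale _ gc sbN) -exprnN -exprVn; congr (_ ^+ _).
  have gb := chart_opp gc sb sbN.
  have g0 : g (b p i) != 0.
    by apply/eqP => g0; move/eqP: gb; rewrite g0 mul0r eq_sym oner_eq0.
  by apply: (mulfI g0); rewrite gb divff.
rewrite [in LHS](bvec_sum hP p m) (chart_sum gc) => [|i]; last exact: (term i).1.
by apply: eq_bigr => i _; exact: (term i).2.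
Qed.

Lemma chart_point_pP p J g : is_chart_point (cone p J, g) -> chart (cone p J) g.
Proof. by case. Qed.

(** The value [g (vpt p - m)] is the homogeneous coordinate at [m], normalised to 1 at [vpt p];
    gluing is proportionality of homogeneous coordinates. For the converse, the monomial map of the
    coordinates [g (b p i)] serves as the common point on the intersection. *)
Lemma glueP p J g q J' g' :
    is_chart_point (cone p J, g) -> is_chart_point (cone q J', g') ->
  glue (cone p J, g) (cone q J', g') <->
  g (vpt p - vpt q) <> 0 /\ forall m, lat P m ->
    g (vpt p - m) = g (vpt p - vpt q) * g' (vpt q - m).
Proof.
move=> ag bg; split=> [[_ _ [d /= [[d0 dM] dg dg']]]|[g0 gg']].
  pose s := cone p J `&` cone q J'.
  have sp m : lat P m -> dual_monoid s (vpt p - m).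
    by move=> Pm; apply: dual_monoidS (dual_vtx _ J Pm) => w [].
  have sq m : lat P m -> dual_monoid s (vpt q - m).
    by move=> Pm; apply: dual_monoidS (dual_vtx _ J' Pm) => w [].
  have Pp := lat_vtx p; have Pq := lat_vtx q.
  split=> [g0|m Pm].
    have /eqP := dM _ _ (sp _ Pq) (sq _ Pp).
    rewrite addrA subrK subrr d0 dg ?g0 ?mul0r ?oner_eq0 //; exact: dual_vtx.
  rewrite -dg -?dg' -?dg; try exact: dual_vtx.
  by rewrite -dM ?subrKA //; [exact: sp|exact: sq].
have gc := chart_point_pP ag; have gc' := chart_point_pP bg.
pose c i := g (b p i).
have gE m : dual_monoid (cone p J) m -> g m = monz p c m by exact: chart_monzE.
have ac0 i : c i = 0 -> a p i (vpt p - vpt q) = 0.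
  move=> ci; move: g0; rewrite gE; last by apply: dual_vtx; exact: lat_vtx.
  by move=> /monz_neq0; apply.
have cp i : c i = 0 -> cone p J (toR R (u p i)).
  move=> ci; apply/cone_uvec => Ji.
  have := chart_opp gc (dual_bvec p J i) (dual_bvecN p Ji).
  by rewrite -/(c i) ci mul0r => /eqP; rewrite eq_sym oner_eq0.
(* A vanishing coordinate [c i] belongs to a facet through [q], whence the inequalities; for [j] in
   [J'] the unit [g' (b q j)] makes the coordinate at the neighbour of [q] nonzero, so that
   neighbour is on the facet too. *)
have cq i : c i = 0 -> cone q J' (toR R (u p i)).
  move=> ci; split=> j; first rewrite acoefR ler0z -acoef_bvec_ge0 ?ac0 //.
    by apply: acoef_ge0; exact: lat_edge.
  move=> Jj; apply/eqP; rewrite acoefR intr_eq0 -acoef_bvec_ge0 ?ac0 //.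
  apply/eqP; have := lat_edge hP q j => Pj.
  have : g (vpt p - (vpt q - b q j)) <> 0.
    rewrite gg' // subKr => /eqP; rewrite mulf_eq0 => /orP[/eqP//|/eqP gj].
    have := chart_opp gc' (dual_bvec q J' j) (dual_bvecN q Jj).
    by rewrite gj mul0r => /eqP; rewrite eq_sym oner_eq0.
  by rewrite gE; [move=> /monz_neq0; apply|exact: dual_vtx].
have mc' : chart (cone q J') (monz p c) by exact: chart_monz.
split=> //; exists (monz p c); split=> /=.
- by apply: chart_monz => i ci; split; [exact: cp|exact: cq].
- by move=> m /gE.
(* It suffices to compare values on the [b q j]; these are differences of [vpt q] and its
   neighbours, hence covered by [gg']. *)
move=> m sm; rewrite (chart_monzE gc' sm) (chart_monzE mc' sm).
apply: eq_bigr => j _; congr (_ ^ _).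
have Pj := lat_edge hP q j.
apply: (mulfI (x := g (vpt p - vpt q))); first exact/eqP.
have -> : g' (b q j) = g' (vpt q - (vpt q - b q j)) by rewrite subKr.
rewrite -gg' // !gE; try by [apply: dual_vtx|apply: dual_vtx; exact: lat_vtx].
rewrite -monzD => [|i ci]; last first.
  by rewrite ac0 // -acoef_bvec_ge0 ?ac0 // acoef_ge0.
by rewrite opprB addrCA (addrC (b q j)).
Qed.

Lemma coords_chart_point x s g : coords x s g -> is_chart_point (s, g).
Proof. by rewrite /coords; case: (svalP x) => a0 _ -> []. Qed.

Lemma coords_hom x p J g q J' g' :
    coords x (cone p J) g -> coords x (cone q J') g' ->
  g (vpt p - vpt q) <> 0 /\ forall m, lat P m ->
    g (vpt p - m) = g (vpt p - vpt q) * g' (vpt q - m).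
Proof.
move=> xg xg'; have ag := coords_chart_point xg; have ag' := coords_chart_point xg'.
move: xg xg'; rewrite /coords; have [[s h] [/= ss hs] ->] := svalP x.
have [r [J0 sE]] := normal_cone_cone hP ss; rewrite sE in ss hs *.
move=> /glueP[||h0 hg] //; move=> /glueP[||h0' hg'] //.
have gE m : lat P m -> g (vpt p - m) =
    (h (vpt r - vpt p))^-1 * h (vpt r - vpt q) * g' (vpt q - m).
  move=> Pm; rewrite -mulrA -hg' // (hg m) // mulKf //; exact/eqP.
have g'0 : g' 0 = 1 by case: (chart_point_pP ag').
have gq : g (vpt p - vpt q) = (h (vpt r - vpt p))^-1 * h (vpt r - vpt q).
  by rewrite gE ?subrr ?g'0 ?mulr1 //; exact: lat_vtx.
split=> [|m Pm]; last by rewrite gq gE.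
by rewrite gq; apply/eqP; rewrite mulf_neq0 ?invr_eq0; apply/eqP.
Qed.

(** Proportionality is transitive, so any coordinates of [x] represent its gluing class. *)
Lemma coords_glue x p J g : coords x (cone p J) g -> sval x = glue (cone p J, g).
Proof.
move=> xg; have ag := coords_chart_point xg.
apply/seteqP; split=> -[s' g'] => [xg'|bg].
  have bg' := coords_chart_point xg'; have [ss' _] := bg'.
  have [q [J' sE]] := normal_cone_cone hP ss'; rewrite /= in sE; subst s'.
  by apply/glueP => //; exact: coords_hom xg xg'.
have [_ bg' _] := bg; have [ss' _] := bg'.
have [q [J' sE]] := normal_cone_cone hP ss'; rewrite /= in sE; subst s'.
have /glueP[||g0 gg'] := bg => //.
move: xg; rewrite /coords; have [[s h] [/= ss hs] ->] := svalP x.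
have [r [J0 sE]] := normal_cone_cone hP ss; rewrite sE in ss hs *.
move=> /glueP[||h0 hg] //; apply/glueP => //.
have hq : h (vpt r - vpt q) = h (vpt r - vpt p) * g (vpt p - vpt q).
  by rewrite hg //; exact: lat_vtx.
split=> [|m Pm]; first by rewrite hq; apply/eqP; rewrite mulf_neq0 //; apply/eqP.
by rewrite hg // gg' // mulrA hq.
Qed.

Lemma pt_subproof p c : exists2 z, is_chart_point z &
  glue (cone p set0, monz p c) = glue z.
Proof.
exists (cone p set0, monz p c) => //.
by split; [exact: vertex_cone_fan|exact: chart_monz_vtx].
Qed.

(* the point of U_p = K^n with coordinates c *)
Definition pt p c : X := exist _ (glue (cone p set0, monz p c)) (pt_subproof p c).

Lemma toric_eq x y : sval x = sval y -> x = y.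
Proof.
case: x y => x hx [y hy] /= xy; case: y / xy hy => hy.
by congr exist; exact: Prop_irrelevance.
Qed.

Lemma chart_point_pt p c : is_chart_point (cone p set0, monz p c).
Proof. by split; [exact: vertex_cone_fan|exact: chart_monz_vtx]. Qed.

Lemma coords_pt p c : coords (pt p c) (cone p set0) (monz p c).
Proof.
have ag := chart_point_pt p c; apply/glueP => //; rewrite subrr monz0.
by split=> [|m _]; [exact/eqP/oner_neq0|rewrite mul1r].
Qed.

Lemma coords_eq_pt x p J g : coords x (cone p J) g ->
  x = pt p (fun i => g (b p i)).
Proof.
move=> xg; apply: toric_eq.
suff : coords x (cone p set0) (monz p (fun i => g (b p i))) by move=> /coords_glue.
have ag := coords_chart_point xg; have gc := chart_point_pP ag.
rewrite /coords (coords_glue xg); apply/glueP => //; first exact: chart_point_pt.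
have [g0 _] := gc; rewrite subrr g0.
split=> [|m Pm]; first exact/eqP/oner_neq0.
rewrite mul1r; apply: chart_monzE gc _; exact: dual_vtx.
Qed.

Lemma pt_exists x : exists p c, x = pt p c.
Proof.
have [[s g] [/= ss gs] xE] := svalP x.
have [p [J sE]] := normal_cone_cone hP ss; rewrite sE in ss gs xE.
exists p, (fun i => g (b p i)); apply: (@coords_eq_pt _ _ J).
rewrite /coords xE; apply/glueP => //.
have [g0 _] := gs; rewrite subrr g0.
by split=> [|m Pm]; [exact/eqP/oner_neq0|rewrite mul1r].
Qed.

Lemma coords_ptE p c J g m : coords (pt p c) (cone p J) g -> lat P m ->
  g (vpt p - m) = monz p c (vpt p - m).
Proof.
move=> xg Pm; have [_ ->//] := coords_hom xg (coords_pt p c).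
have [g0 _] := chart_point_pP (coords_chart_point xg).
by rewrite subrr g0 mul1r.
Qed.

Lemma pt_inj p : injective (pt p).
Proof.
move=> c c' cc; apply/funext => i.
have := coords_pt p c; rewrite cc => /coords_ptE/(_ (lat_edge hP p i)).
by rewrite subKr !monz_bvec => ->.
Qed.

(* the lattice points of P whose homogeneous coordinate at x is nonzero *)
Definition supp x : set 'rV[int]_n :=
  [set m | lat P m /\ exists p c, x = pt p c /\ monz p c (vpt p - m) <> 0].

Lemma coords_supp x p J g m : coords x (cone p J) g ->
  supp x m <-> lat P m /\ g (vpt p - m) <> 0.
Proof.
move=> xg; split=> [[Pm [q [c [xE cm]]]]|[Pm gm]]; split=> //.
  rewrite xE in xg; have [g0 ->//] := coords_hom xg (coords_pt q c).
  by apply/eqP; rewrite mulf_neq0 //; apply/eqP.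
have xE := coords_eq_pt xg; exists p, (fun i => g (b p i)); split=> //.
rewrite -(@chart_monzE _ J) //; first exact: (chart_point_pP (coords_chart_point xg)).
exact: dual_vtx.
Qed.

Lemma supp_pt p c : supp (pt p c) = fset_at hP p [set i | c i != 0].
Proof.
apply/seteqP; split=> m.
  move=> /(coords_supp _ (coords_pt p c))[Pm /monz_neq0 h]; split=> // i ci.
  by apply: h; apply/eqP; apply: contrapT => /negP.
move=> [Pm h]; apply/(coords_supp _ (coords_pt p c)); split=> //.
by apply/monz_neq0 => i ci; apply: h => /=; rewrite ci eqxx.
Qed.

Lemma supp_edge p c i : supp (pt p c) (vpt p - b p i) <-> c i != 0.
Proof. by rewrite supp_pt fset_edge. Qed.

(** If the coordinate at [q] is nonzero, every facet on which [x] has a vanishing coordinate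
    contains [q], so the characters [b q i] are defined at [x] and give its coordinates on [U_q]. *)
Lemma supp_chart x q : supp x (vpt q) <-> exists c, x = pt q c.
Proof.
split=> [|[c ->]]; last by rewrite supp_pt; exact: fset_vtx.
have [p [c ->]] := pt_exists x.
move=> /(coords_supp _ (coords_pt p c))[_ cq].
exists (fun i => monz p c (b q i)).
apply: (@coords_eq_pt _ _ set0); have /monz_neq0 acq := cq.
have cq0 i : c i = 0 -> cone q set0 (toR R (u p i)).
  move=> ci; split=> // j; rewrite acoefR ler0z -acoef_bvec_ge0 ?acq //.
  by apply: acoef_ge0; exact: lat_edge.
have ag : is_chart_point (cone q set0, monz p c).
  by split; [exact: vertex_cone_fan|exact: chart_monz].
apply/glueP => //; first exact: chart_point_pt.
split=> // m Pm; rewrite -monzD ?subrKA // => i ci.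
have := acoef_ge0 hP p i Pm; have := acq i ci; rewrite !acoefB.
by move=> h; rewrite h; move: h; lia.
Qed.

End Points.

(** * Orbits and orbit closures *)

Section Topology.
Context {R : realType} {n : nat} {P : set 'rV[R]_n}.
Hypothesis hP : smooth_full_dim_lattice_polytope P.
Context (K : closedFieldType).
Local Notation b := (bvec hP).
Local Notation u := (uvec hP).
Local Notation a := (acoef hP).
Local Notation cone := (cone hP).
Local Notation Sigma := (outer_normal_fan P).
Local Notation X := (toric_variety K Sigma).
Local Notation pt := (@pt R n P hP K).
Local Notation supp := (@supp R n P hP K).
Local Notation fset_at := (fset_at hP).
Implicit Types (p q r : vtx P) (m : 'rV[int]_n) (I : set 'I_n) (A : set 'rV[int]_n).
Implicit Types (c : 'I_n -> K) (x y : X) (C Y : set X) (t : @torus n K).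

(** For the lattice points of a face, the closure of its orbit; for the complement of one point [m],
    the locus where the homogeneous coordinate at [m] vanishes. *)
Definition zset A : set X := [set x | supp x `<=` A].

Lemma zset_closed A : closed (zset A).
Proof.
apply/toric_closedE => s ss; have [p [J ->]] := normal_cone_cone hP ss.
exists [set f | exists m, [/\ lat P m, ~ A m & f = [:: (1, vpt p - m)]]].
  move=> _ [m [Pm _ ->]] c; rewrite inE => /eqP -> /=; exact: dual_vtx.
move=> x g xg; split=> [xA _ [m [Pm nAm ->]]|h m].
  rewrite /eval_regular big_seq1 mul1r; apply: contra_notP nAm => gm.
  by apply: xA; apply/(coords_supp m xg).
move=> /(coords_supp m xg)[Pm gm]; apply: contrapT => nAm; apply: gm.
have := h [:: (1, vpt p - m)]; rewrite /eval_regular big_seq1 mul1r; apply.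
by exists m.
Qed.

Lemma act_pt t p c : act t (pt p c) = pt p (fun i => chi (b p i) t * c i).
Proof.
have : coords (act t (pt p c)) (cone p set0)
    (fun m => chi m t * monz hP p c m).
  exists (cone p set0, monz hP p c) => //.
  exact: (coords_pt hP (K := K) p c).
move=> /coords_eq_pt ->; congr pt; apply/funext => i.
by rewrite monz_bvec.
Qed.

Lemma supp_act t x : supp (act t x) = supp x.
Proof.
have [p [c ->]] := pt_exists hP x; rewrite act_pt !supp_pt; congr fset_at.
by apply/seteqP; split=> i /=; rewrite mulf_eq0 (negbTE (chi_neq0 _ _)).
Qed.

Lemma zset_stable A : T_stable (zset A).
Proof. by move=> t x; rewrite /zset /= supp_act. Qed.

Lemma closed_separation C p c : closed C -> ~ C (pt p c) ->
  exists2 f, regular (cone p set0) f &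
    eval_regular f (monz hP p c) <> 0 /\
    forall c', C (pt p c') -> eval_regular f (monz hP p c') = 0.
Proof.
move=> /toric_closedE/(_ _ (vertex_cone_fan hP p))[J Jreg CJ] nC.
have [f /not_implyP[Jf f0]] : exists f, ~ (J f -> eval_regular f (monz hP p c) = 0).
  apply/existsNP => h; apply: nC; apply/(CJ _ _ (coords_pt hP p c)).
  exact: h.
exists f; first exact: Jreg.
by split=> // c' /(CJ _ _ (coords_pt hP p c'))/(_ _ Jf).
Qed.

Lemma regular_line p f c e : regular (cone p set0) f ->
  exists F : {poly K}, forall z,
    F.[z] = eval_regular f (monz hP p (fun i => c i + z * e i)).
Proof.
move=> freg.
exists (\sum_(k <- f) k.1 *: \prod_i ((c i)%:P + (e i) *: 'X) ^+ absz (a p i k.2)).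
move=> z; rewrite horner_sum /eval_regular; apply: eq_big_seq => k kf.
rewrite hornerZ horner_prod; congr (_ * _); apply: eq_bigr => i _.
rewrite horner_exp hornerD hornerC hornerZ hornerX mulrC.
have : 0 <= a p i k.2 by move/dual_cone: (freg _ kf); apply.
by case: (a p i k.2).
Qed.

(** Reduces density and irreducibility to nonzero polynomials in one variable, which have a nonroot
    over an algebraically closed field. *)
Lemma line_avoid C p c e : closed C -> ~ C (pt p c) ->
  exists2 F : {poly K}, F.[0] != 0 &
    forall z, F.[z] != 0 -> ~ C (pt p (fun i => c i + z * e i)).
Proof.
move=> Ccl nC; have [f freg [f0 fC]] := closed_separation Ccl nC.
have [F FE] := regular_line c e freg; exists F.
  rewrite FE; have -> : (fun i => c i + 0 * e i) = c.
    by apply/funext => i; rewrite mul0r addr0.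
  exact/eqP.
by move=> z + /fC; rewrite FE => /eqP.
Qed.

Lemma nonroot (F : {poly K}) : F != 0 -> exists z, F.[z] != 0.
Proof. by move=> /closed_nonrootP[z]; exists z. Qed.

Lemma poly_neq0 (F : {poly K}) z : F.[z] != 0 -> F != 0.
Proof. by apply: contraNneq => ->; rewrite horner0. Qed.

(* The points of the open orbit of the face A near x form the line
   c + z 1_I in the chart of a vertex q with x in U_q. *)
Lemma orbit_near C x p I : closed C -> ~ C x -> supp x `<=` fset_at p I ->
  exists2 y, ~ C y & supp y = fset_at p I.
Proof.
move=> Ccl nC xI; have [q [c xE]] := pt_exists hP x; subst x.
have qI : fset_at p I (vpt q) by apply: xI; rewrite supp_pt; exact: fset_vtx.
rewrite (fset_rebase qI) in xI *; set J := [set i | _] in xI *.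
pose e i : K := (`[< J i >])%:R.
have [F F0 FC] := line_avoid e Ccl nC.
(* The product keeps every coordinate in [J] nonzero, so the support is the whole face. *)
have [|z] := nonroot (F := F * \prod_(i | `[< J i >]) ((c i)%:P + 'X)).
  rewrite mulf_neq0 ?(poly_neq0 F0) //; apply/prodf_neq0 => i _.
  by rewrite addrC -[c i]opprK polyCN polyXsubC_eq0.
rewrite hornerM mulf_eq0 negb_or horner_prod => /andP[Fz /prodf_neq0 cz].
exists (pt q (fun i => c i + z * e i)); first exact: FC.
rewrite supp_pt; congr fset_at; apply/seteqP; split=> i /=; rewrite /e.
  case: asboolP => // nJ; rewrite mulr0 addr0 => ci; exfalso; apply: nJ.
  by rewrite -(fset_edge hP q J i); apply: xI; apply/supp_edge.
move=> Ji; have iJ : `[< J i >] by apply/asboolP.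
by rewrite iJ mulr1; have := cz i iJ; rewrite hornerD hornerC hornerX.
Qed.

Lemma zset_dense C p I : closed C ->
  (forall x, supp x = fset_at p I -> C x) -> zset (fset_at p I) `<=` C.
Proof.
move=> Ccl h x xI; apply: contrapT => nC.
by have [y nCy /h] := orbit_near Ccl nC xI.
Qed.

Lemma orbit_exists p I : exists x, supp x = fset_at p I.
Proof.
exists (pt p (fun i => (`[< I i >])%:R)); rewrite supp_pt; congr fset_at.
apply/seteqP; split=> i /=; case: asboolP => //; first by rewrite eqxx.
by move=> _ _; exact: oner_neq0.
Qed.

(** A point outside [C] and one outside [D] are moved into the open orbit, where both lie in [U_p];
    a general point of the line joining them avoids [C] and [D]. *)
Lemma zset_irreducible p I : irreducible (zset (fset_at p I)).
Proof.
split.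
  by have [x xI] := orbit_exists p I; exists x; rewrite /zset /= xI.
move=> C D Ccl Dcl CD; apply: contrapT => /not_orP[].
move=> /existsNP[x /not_implyP[xI nCx]] /existsNP[y /not_implyP[yI nDy]].
have [x' nCx' x'E] := orbit_near Ccl nCx xI.
have [y' nDy' y'E] := orbit_near Dcl nDy yI.
have /(supp_chart hP)[c x'p] : supp x' (vpt p) by rewrite x'E; exact: fset_vtx.
have /(supp_chart hP)[d y'p] : supp y' (vpt p) by rewrite y'E; exact: fset_vtx.
subst x' y'.
have [F F0 FC] := line_avoid (fun i => d i - c i) Ccl nCx'.
have [G G0 GD] := line_avoid (fun i => c i - d i) Dcl nDy'.
(* [G] parametrises the same line from its other end, hence the substitution. *)
have [|z] := nonroot (F := F * (G \Po (1 - 'X))).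
  rewrite mulf_neq0 ?(poly_neq0 F0) //; apply: (@poly_neq0 _ 1).
  by rewrite horner_comp hornerD hornerN hornerX hornerC subrr.
rewrite hornerM mulf_eq0 negb_or horner_comp hornerD hornerN hornerX hornerC.
move=> /andP[/FC nC /GD].
have -> : (fun i => d i + (1 - z) * (c i - d i)) = (fun i => c i + z * (d i - c i)).
  by apply/funext => i; ring.
move=> nD; case: (CD (pt p (fun i => c i + z * (d i - c i)))) => //.
rewrite /zset /= supp_pt => m [Pm hm]; split=> // i nIi; apply: hm => /=.
have zero w : supp (pt p w) = fset_at p I -> w i = 0.
  move=> wE; apply/eqP; apply: contra_notT nIi => wi.
  by rewrite -(fset_edge hP p I i) -wE; apply/supp_edge.
by rewrite (zero _ x'E) (zero _ y'E) subrr mulr0 addr0 eqxx.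
Qed.

Lemma cocharE m (w : 'rV[int]_n) (z : Gm K) :
  chi m (cochar w z) = val z ^ pairing m w.
Proof.
rewrite /chi /pairing; elim/big_rec2: _ => // i x1 y1 _ ->.
by rewrite expfzDr ?(valP z) //= [m _ _ * _]mulrC exprz_exp.
Qed.

Definition tmul (t t' : @torus n K) : @torus n K :=
  fun i => exist _ (val (t i) * val (t' i))
             (mulf_neq0 (valP (t i)) (valP (t' i))).

Lemma chi_tmul m t t' : chi m (tmul t t') = chi m t * chi m t'.
Proof.
by rewrite /chi -big_split; apply: eq_bigr => i _; rewrite /= expfzMl.
Qed.

Lemma torus_coords p (r : 'I_n -> K) : (forall i, r i != 0) ->
  exists t, forall i, chi (b p i) t = r i.
Proof.
move=> r0; pose one : Gm K := exist _ 1 (oner_neq0 K).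
pose T (s : seq 'I_n) : @torus n K :=
  foldr (fun i t => tmul (cochar (u p i) (exist _ (r i) (r0 i))) t)
        (fun=> one) s.
have TE s j : chi (b p j) (T s) = \prod_(i <- s) r i ^ (i == j)%:R.
  elim: s => [|i s IH] /=.
    by rewrite big_nil /chi big1 // => k _; rewrite exp1rz.
  by rewrite chi_tmul cocharE bvec_dual big_cons IH.
exists (T (index_enum 'I_n)) => j; rewrite TE (bigD1 j) //= eqxx big1 ?mulr1 //.
by move=> i /negbTE ->.
Qed.

Lemma torus_transitive x y : supp x = supp y -> exists t, act t x = y.
Proof.
have [p [c ->]] := pt_exists hP x => cy.
have /(supp_chart hP)[d yE] : supp y (vpt p).
  by rewrite -cy supp_pt; exact: fset_vtx.
subst y; have cd i : (c i != 0) = (d i != 0).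
  by apply/idP/idP => [/(supp_edge hP p)|/(supp_edge hP p)];
    [rewrite cy|rewrite -cy] => /supp_edge.
(* A coordinate that vanishes at [x] vanishes at [y] too, so any nonzero factor would do there. *)
have [|t tE] := @torus_coords p (fun i => if c i == 0 then 1 else d i / c i).
  move=> i; case: ifPn => [_|ci]; first exact: oner_neq0.
  by rewrite mulf_neq0 ?invr_eq0 // -cd.
exists t; rewrite act_pt; congr pt; apply/funext => i; rewrite tE.
case: ifPn => [/eqP ci|ci]; last by rewrite divfK.
by apply/esym/eqP; rewrite ci mulr0; apply: contraT; rewrite -cd ci eqxx.
Qed.

Lemma irreducible_avoid (Y : set X) (S : seq 'rV[int]_n) (F : 'rV[int]_n -> set X) :
    irreducible Y -> (forall m, m \in S -> closed (F m) /\ ~ (Y `<=` F m)) ->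
  exists2 y, Y y & forall m, m \in S -> ~ F m y.
Proof.
move=> [Y0 Yirr] hS.
suff [U [Ucl nYU SU]] : exists U, [/\ closed U, ~ (Y `<=` U) &
    forall m, m \in S -> F m `<=` U].
  move: nYU => /existsNP[y /not_implyP[Yy nUy]]; exists y => // m /SU FU.
  by move/FU.
elim: S hS => [|m S IH] hS.
  exists set0; split=> //; first exact: closed0.
  by case: Y0 => y Yy /(_ y Yy).
have [m' m'S|U [Ucl nYU SU]] := IH; first by apply: hS; rewrite inE m'S orbT.
have [Fcl nYF] := hS m (mem_head _ _).
exists (F m `|` U); split; first exact: closedU.
  by move=> /(Yirr _ _ Fcl Ucl)[].
by move=> m'; rewrite inE => /orP[/eqP ->|/SU FU] x Fx; [left|right; exact: FU].
Qed.

Lemma zset_avoid m x : zset (~` [set m]) x <-> ~ supp x m.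
Proof. by split=> [h /h|h m' xm' /= m'm]; [exact|apply: h; rewrite -m'm]. Qed.

(** Irreducibility yields one point [y] at which every coordinate that is not identically 0 on [Y],
    among those at [p] and its neighbours, is nonzero. Its support is the face sought, and its orbit
    is dense in [Y]. *)
Lemma stable_subvariety Y : subvariety Y -> T_stable Y ->
  exists p I, Y = zset (fset_at p I).
Proof.
move=> [Ycl Yirr] Yst; have [[x0 Yx0] _] := Yirr.
have [p [c0 x0E]] := pt_exists hP x0.
pose I := [set i | exists2 y, Y y & supp y (vpt p - b p i)].
pose S := vpt p :: [seq vpt p - b p i | i <- enum 'I_n & `[< I i >]].
have [|y Yy yS] := irreducible_avoid (S := S) (F := fun m => zset (~` [set m])) Yirr.
  move=> m; rewrite inE => mS; split; first exact: zset_closed.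
  case/orP: mS => [/eqP ->|/mapP[i]].
    by move/(_ _ Yx0)/zset_avoid; apply; rewrite x0E supp_pt; exact: fset_vtx.
  by rewrite mem_filter => /andP[/asboolP[z Yz zi] _] -> /(_ _ Yz)/zset_avoid.
have yp : supp y (vpt p).
  by apply: contrapT => /zset_avoid; apply: yS; exact: mem_head.
have yi i : I i -> supp y (vpt p - b p i).
  move=> Ii; apply: contrapT => /zset_avoid; apply: yS.
  rewrite inE; apply/orP; right; apply/mapP; exists i => //.
  by rewrite mem_filter mem_enum andbT; apply/asboolP.
have zy z : Y z -> supp z (vpt p) -> exists2 J, J `<=` I & supp z = fset_at p J.
  move=> Yz /(supp_chart hP)[c zE]; subst z; exists [set i | c i != 0].
    by move=> i /= ci; exists (pt p c) => //; apply/supp_edge.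
  exact: supp_pt.
have yI : supp y = fset_at p I.
  have [J JI yJ] := zy y Yy yp; apply/seteqP; split.
    by rewrite yJ; exact: fset_sub.
  by rewrite yJ; apply: fset_sub => i /yi; rewrite yJ fset_edge.
exists p, I; apply/seteqP; split; last first.
  apply: zset_dense => // x xI; have [|t <-] := @torus_transitive y x.
    by rewrite yI.
  exact: Yst.
(* [zy] controls only the points in [U_p]; irreducibility disposes of the others. *)
have [_ /(_ _ _ (@zset_closed (fset_at p I)) (@zset_closed (~` [set vpt p])))] := Yirr.
case=> // [z Yz|h]; last by have /zset_avoid := h _ Yy.
have [zp|nzp] := pselect (supp z (vpt p)); last by right; apply/zset_avoid.
by left; have [J JI zJ] := zy z Yz zp; rewrite /zset /= zJ; exact: fset_sub.
Qed.

End Topology.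

(** * Bialynicki-Birula cells *)

Section BialynickiBirula.
Context {R : realType} {n : nat} {P : set 'rV[R]_n}.
Hypothesis hP : smooth_full_dim_lattice_polytope P.
Context (K : closedFieldType).
Local Notation b := (bvec hP).
Local Notation a := (acoef hP).
Local Notation cone := (cone hP).
Local Notation Sigma := (outer_normal_fan P).
Local Notation X := (toric_variety K Sigma).
Local Notation pt := (@pt R n P hP K).
Local Notation supp := (@supp R n P hP K).
Local Notation zset := (@zset R n P hP K).
Local Notation fset_at := (fset_at hP).
Implicit Types (p q r : vtx P) (m : 'rV[int]_n) (I : set 'I_n) (A : set 'rV[int]_n).
Implicit Types (c : 'I_n -> K) (x y : X) (C Y : set X) (t : @torus n K).

Definition fixpt p : X := pt p (fun=> 0).

Lemma supp_fixpt p : supp (fixpt p) = [set vpt p].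
Proof.
rewrite supp_pt; apply/seteqP; split=> m /= => [[_ h]|->]; last exact: fset_vtx.
apply/eqP; rewrite eq_sym -subr_eq0 (bvec_sum hP p (vpt p - m)) big1 // => i _.
by rewrite h ?scale0r //=; rewrite eqxx.
Qed.

Lemma chi_bvec_neq1 p i : exists t, chi (b p i) t != 1.
Proof.
have [|z] := nonroot (F := 'X * ('X - 1%:P) : {poly K}).
  by rewrite mulf_neq0 ?polyX_eq0 // polyXsubC_eq0.
rewrite hornerM hornerX hornerD hornerN hornerC hornerX mulf_eq0 negb_or subr_eq0.
move=> /andP[z0 z1]; have [//|t tE] := @torus_coords _ _ _ hP K p (fun=> z).
by exists t; rewrite tE.
Qed.

Lemma fixed_TP x : fixed_T x <-> exists p, x = fixpt p.
Proof.
split=> [xT|[p ->] t]; last first.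
  by rewrite act_pt; congr pt; apply/funext => i; rewrite mulr0.
have [p [c xE]] := pt_exists hP x; exists p; subst x.
congr pt; apply/funext => i; have [t t1] := chi_bvec_neq1 p i.
have := xT t; rewrite act_pt => /pt_inj/(congr1 (@^~ i)) /= ci.
apply/eqP; apply: contraNT t1 => c0; apply/eqP.
by apply: (mulIf c0); rewrite ci mul1r.
Qed.

(** If [v] were perpendicular to the edge [i] at [p], the point of [U_p] with [i]-th coordinate 1
    and all others 0 would be fixed by the one-parameter group but not by [T]. *)
Lemma admissible_edge v : admissible K Sigma v ->
  forall p i, pairing (b p i) v != 0.
Proof.
move=> adm p i; apply/negP => /eqP bv.
have [t t1] := chi_bvec_neq1 p i.
pose x := pt p (fun j => (j == i)%:R).
have : fixed_T x.
  rewrite -adm => z; rewrite act_pt; congr pt; apply/funext => j.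
  rewrite cocharE; have [->|_] := eqVneq j i; last by rewrite mulr0.
  by rewrite bv expr0z mul1r.
move=> /(_ t); rewrite act_pt => /pt_inj/(congr1 (@^~ i)) /=.
by rewrite eqxx mulr1 => /eqP; rewrite (negbTE t1).
Qed.

Section Cells.
Variable v : 'rV[int]_n.
Hypothesis v_edge : forall p i, pairing (b p i) v != 0.
Local Notation flow := (flow hP v).

Lemma flow_lim x p : supp x (vpt p) -> supp x `<=` flow p ->
  lim_at0 v x (fixpt p).
Proof.
move=> /supp_chart[c ->{x}] cflow.
have bv i : c i != 0 -> 0 < pairing (b p i) v.
  by move=> ci; apply/(fset_edge hP p [set i | 0 < pairing (b p i) v]);
    apply: cflow; apply/supp_edge.
(* Where [c i] is nonzero the pairing is positive, so the absolute value changes nothing; all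
   exponents are nonzero by [v_edge], so [phi 0] is the origin. *)
pose phi z i := c i * z ^+ absz (pairing (b p i) v).
exists (fun z => pt p (phi z)); split.
- move=> z; exists (cone p set0), 1; split.
  + exact: vertex_cone_fan.
  + by rewrite hornerC oner_neq0.
  exists (fun z => monz hP p (phi z)) => [t _|m sm]; first exact: coords_pt.
  exists (\prod_i (c i *: 'X^(absz (pairing (b p i) v))) ^+ absz (a p i m)), 0%N.
  move=> t _; rewrite expr0 divr1 horner_prod; apply: eq_bigr => i _.
  rewrite horner_exp hornerZ hornerXn -/(phi t i).
  have : 0 <= a p i m by move/dual_cone: sm; apply.
  by case: (a p i m).
- congr pt; apply/funext => i; rewrite /phi expr0n absz_eq0.
  by rewrite (negbTE (v_edge p i)) mulr0.
move=> t; rewrite act_pt; congr pt; apply/funext => i.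
rewrite cocharE mulrC /phi; have [->|/bv] := eqVneq (c i) 0; first by rewrite !mul0r.
by case: (pairing (b p i) v).
Qed.

Lemma poly_ext0 (F G : {poly K}) (h : {poly K}) : h != 0 ->
  (forall z, z != 0 -> h.[z] != 0 -> F.[z] = G.[z]) -> F = G.
Proof.
move=> h0 FG; apply/eqP; rewrite -subr_eq0; apply: contraT => FG0.
have [|z] := nonroot (F := (F - G) * ('X * h)).
  by rewrite !mulf_neq0 // polyX_eq0.
rewrite !hornerM hornerX hornerD hornerN !mulf_eq0 !negb_or => /and3P[+ z0 hz].
by rewrite FG // subrr eqxx.
Qed.

Lemma lim_flow x p : lim_at0 v x (fixpt p) ->
  supp x (vpt p) /\ supp x `<=` flow p.
Proof.
move=> [phi [mor phi0 phiE]].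
have [s [h [ss h0 [g gphi greg]]]] := mor 0.
have [r [J sE]] := normal_cone_cone hP ss; subst s.
have hne : h != 0 := poly_neq0 h0.
(* A chart based at [r] contains only points with nonzero coordinate at [r], and the limit has
   support [vpt p] alone. *)
have rp : r = p.
  apply: vpt_inj; have : supp (phi 0) (vpt r).
    apply/(coords_supp (vpt r) (gphi _ h0)); split; first exact: lat_vtx.
    have [_ [g0 _]] := coords_chart_point (gphi _ h0).
    by rewrite subrr; move: g0 => /= ->; exact/eqP/oner_neq0.
  by rewrite phi0 supp_fixpt.
subst r.
have [z z0 hz] : exists2 z, z != 0 & h.[z] != 0.
  have [|z] := nonroot (F := 'X * h); first by rewrite mulf_neq0 ?polyX_eq0.
  by rewrite hornerM hornerX mulf_eq0 negb_or => /andP[]; exists z.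
have xp : supp x (vpt p).
  rewrite -(supp_act hP (cochar v (exist _ z z0))) -phiE.
  apply/(coords_supp (vpt p) (gphi _ hz)); split; first exact: lat_vtx.
  have [_ [g0 _]] := coords_chart_point (gphi _ hz).
  by rewrite subrr; move: g0 => /= ->; exact/eqP/oner_neq0.
split=> //; have [c xE] := (supp_chart hP x p).1 xp; subst x.
rewrite supp_pt; apply: fset_sub => i /= ci.
rewrite lt0r v_edge /= leNgt; apply/negP => bv.
have sb : dual_monoid (cone p J) (b p i) by exact: dual_bvec.
have [f [k fE]] := greg _ sb.
have gE (t : K) : h.[t] != 0 -> forall c', phi t = pt p c' -> g t (b p i) = c' i.
  move=> ht c' phit; have := gphi _ ht; rewrite phit.
  move=> /coords_ptE/(_ (lat_edge hP p i)).
  by rewrite subKr monz_bvec.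
have f0 : f.[0] = 0.
  have /eqP := gE 0 h0 _ phi0; rewrite fE // mulf_eq0 invr_eq0.
  by rewrite (negbTE (expf_neq0 k h0)) orbF => /eqP.
pose N := absz (pairing (b p i) v).
(* On the punctured line the coordinate [f / h ^ k] equals [c i] times the power [- N] of the
   parameter. The resulting polynomial identity extends to 0, where only its left side vanishes. *)
have /(congr1 (fun F => F.[0])) : 'X^N * f = c i *: h ^+ k.
  apply: (poly_ext0 hne) => t t0 ht.
  have := gE t ht _ (etrans (phiE (exist _ t t0)) (act_pt _ _ _ _)).
  rewrite fE // cocharE /= hornerM hornerXn hornerZ horner_exp.
  have -> : pairing (b p i) v = - N%:Z by rewrite /N; lia.
  rewrite -exprnN => /(canRL (divfK (expf_neq0 k ht))) ->.
  by rewrite !mulrA divff ?mul1r // expf_neq0.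
rewrite hornerM f0 mulr0 hornerZ horner_exp => /esym/eqP.
by rewrite mulf_eq0 (negbTE ci) (negbTE (expf_neq0 k h0)).
Qed.

Lemma BB_cellP Y p x : BB_cell v Y (fixpt p) x <->
  [/\ Y x, supp x (vpt p) & supp x `<=` flow p].
Proof.
by split=> [[Yx /lim_flow[]]//|[Yx xp xflow]]; split=> //; exact: flow_lim.
Qed.

(** Seen from [p], the intersection is again a face, and its open orbit, which is dense in its
    [zset], lies in the cell. *)
Lemma closure_cell r I p : fset_at r I (vpt p) ->
  closure (BB_cell v (zset (fset_at r I)) (fixpt p)) =
  zset (fset_at r I `&` flow p).
Proof.
move=> rp; rewrite (fset_rebase rp) /flow fset_setI; apply/seteqP; split.
  rewrite closureE; apply: smallest_sub; first exact: zset_closed.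
  move=> x /BB_cellP[xA _ xf]; rewrite /zset /= -fset_setI => m xm.
  by split; [exact: xA|exact: xf].
apply: zset_dense; first exact: closed_closure.
move=> x xE; apply: subset_closure; apply/BB_cellP.
rewrite /zset /= xE; split; first by apply: fset_sub => i [].
  exact: fset_vtx.
by apply: fset_sub => i [].
Qed.

Lemma stratifies_zset r I :
  stratifies v (zset (fset_at r I)) <-> flow_closed hP v (fset_at r I).
Proof.
set A := fset_at r I; split=> [strat p q Ap Aq pq m [qm Am]|fc x [Ax]].
  have [|I0 I0T clE] := strat (fixpt p).
    split; last by apply/fixed_TP; exists p.
    by rewrite /zset /= supp_fixpt => _ ->.
  rewrite closure_cell // in clE.
  have I0q : I0 (fixpt q).
    have : (zset A `&` zset (A `&` flow p)) (fixpt q).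
      by split; rewrite /zset /= supp_fixpt => _ ->.
    rewrite clE => -[y I0y]; have [_ /fixed_TP[q' yE]] := I0T _ I0y; subst y.
    by move=> /BB_cellP[_]; rewrite supp_fixpt => /vpt_inj <-.
  have AE := fset_rebase Aq; have [x xE] := orbit_exists hP K q
    ([set i | 0 < pairing (b q i) v] `&` [set i | fset_at r I (vpt q - b q i)]).
  rewrite -fset_setI -AE -/A in xE.
  have : (zset A `&` zset (A `&` flow p)) x.
    rewrite clE; exists (fixpt q) => //; apply/BB_cellP; rewrite /zset /= xE.
    by split=> [m' []//||m' []//]; split=> //; exact: fset_vtx.
  by move=> [_]; rewrite /zset /= xE => /(_ m)[].
move=> /fixed_TP[p xE]; subst x.
have Ap : A (vpt p) by apply: Ax; rewrite supp_fixpt.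
exists [set y | exists q, [/\ y = fixpt q, A (vpt q) & flow p (vpt q)]].
  move=> _ [q [-> Aq pq]]; split; last by apply/fixed_TP; exists q.
  by rewrite /zset /= supp_fixpt => _ ->.
rewrite closure_cell //; apply/seteqP; split=> x.
  move=> [xA xAp]; have [s [c xE]] := pt_exists hP x.
  have [q] := max_flow v_edge s [set i | c i != 0].
  rewrite -(supp_pt hP s c) -xE => xq xflow.
  have [Aq pq] := xAp _ xq; exists (fixpt q); first by exists q.
  by apply/BB_cellP.
move=> [_ [q [-> Aq pq]] /BB_cellP[xA xq xflow]]; split=> // m xm.
split; first exact: xA.
by apply: (fc p q) => //; split; [exact: xflow|exact: xA].
Qed.

End Cells.
End BialynickiBirula.

(** * Dimension *)

Lemma linear_dependence (K : fieldType) (S T : finType) (F : T -> S -> K) :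
  (#|S| < #|T|)%N ->
  exists2 l : T -> K, exists t, l t != 0 & forall s, \sum_t l t * F t s = 0.
Proof.
move=> ST.
pose M := \matrix_(i < #|T|, j < #|S|) F (enum_val i) (enum_val j).
have : kermx M != 0.
  rewrite -mxrank_eq0 mxrank_ker subn_eq0 -ltnNge.
  exact: leq_ltn_trans (rank_leq_col M) ST.
case/rowV0Pn => w /sub_kermxP wM w0.
exists (fun t => w 0 (enum_rank t)).
  have [i wi] := rV0Pn _ w0.
  by exists (enum_val i); rewrite enum_valK.
move=> s; have /rowP/(_ (enum_rank s)) := wM; rewrite !mxE => wMs.
apply: etrans wMs; rewrite (reindex _ (onW_bij _ (@enum_val_bij T))) /=.
by apply: eq_bigr => i _; rewrite mxE !enum_rankK enum_valK.
Qed.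

Section ChartFunctions.
Context {R : realType} {n : nat} {P : set 'rV[R]_n}.
Hypothesis hP : smooth_full_dim_lattice_polytope P.
Context (K : closedFieldType).
Local Notation b := (bvec hP).
Local Notation a := (acoef hP).
Local Notation cone := (cone hP).
Local Notation Sigma := (outer_normal_fan P).
Local Notation X := (toric_variety K Sigma).
Local Notation pt := (@pt R n P hP K).
Local Notation monz := (@monz R n P hP K).
Implicit Types (q r : vtx P) (m : 'rV[int]_n) (c : 'I_n -> K) (x y : X).
Implicit Types (f : seq (K * 'rV[int]_n)) (h : ('I_n -> K) -> K) (Z : set X).
Variable p : vtx P.

Definition regfun h : Prop := exists2 f, regular (cone p set0) f &
  forall c, h c = eval_regular f (monz p c).

(** Every point outside [U_p] is included, so that the set is closed in [X] and not just in the
    chart. *)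
Definition vanishing h : set X := [set x | forall c, x = pt p c -> h c = 0].

(* chi^(k (r - p)) clears the denominators of chi^m on U_r. *)
Lemma dual_clear_denominators r m (k : nat) :
    (forall i, 0 <= a p i m) -> \sum_i a p i m <= k%:Z ->
  dual_monoid (cone r set0) (m + k%:Z *: (vpt r - vpt p)).
Proof.
move=> am mk; apply/dual_cone => l _.
have rp0 := acoef_ge0 hP r l (lat_vtx p).
rewrite acoefD {1}/acoef (pairing_bvec hP p) {2}/acoef pairingZl.
rewrite -!/(acoef hP _ _ _).
have -> : \sum_i a p i m * a r l (b p i) =
    \sum_i a p i m * a r l (vpt r - (vpt p - b p i)) -
    (\sum_i a p i m) * a r l (vpt r - vpt p).
  rewrite mulr_suml -sumrB; apply: eq_bigr => i _.
  by rewrite !acoefB; ring.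
rewrite -addrA -mulNr -mulrDl addr_ge0 //; last first.
  by apply: mulr_ge0 rp0; rewrite addrC subr_ge0.
by apply: sumr_ge0 => i _; rewrite mulr_ge0 // acoef_ge0 //; exact: lat_edge.
Qed.

Lemma vanishing_closed h : regfun h -> closed (vanishing h).
Proof.
move=> [f freg fE]; apply/toric_closedE => s ss.
have [r [J sE]] := normal_cone_cone hP ss; subst s.
pose k := (\sum_(e <- f) absz (\sum_i a p i e.2)%R)%N.
(* The power [k] clears denominators; the extra one makes the equation hold at every point of [U_r]
   outside [U_p]. *)
pose fr := [seq (e.1, e.2 + k.+1%:Z *: (vpt r - vpt p)) | e <- f].
have dualr : cone r J `<=` cone r set0 by exact: cone_sub.
have am e : e \in f -> forall i, 0 <= a p i e.2.
  by move=> ef i; move/dual_cone: (freg _ ef); apply.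
have ek e : e \in f -> \sum_i a p i e.2 <= k%:Z.
  move=> ef; rewrite /k (big_rem e ef) /=.
  by apply: (le_trans (lez_abs _)); rewrite lez_nat leq_addr.
have dk e k' : e \in f -> \sum_i a p i e.2 <= k'%:Z ->
    dual_monoid (cone r J) (e.2 + k'%:Z *: (vpt r - vpt p)).
  move=> ef ek'; apply: (dual_monoidS dualr).
  by apply: dual_clear_denominators => //; exact: am.
have dr : dual_monoid (cone r J) (vpt r - vpt p).
  by apply: dual_vtx; exact: lat_vtx.
have eS e : e.2 + k.+1%:Z *: (vpt r - vpt p) =
    (e.2 + k%:Z *: (vpt r - vpt p)) + (vpt r - vpt p) :> 'rV[int]_n.
  by rewrite intS scalerDl scale1r [LHS]addrA [RHS]addrAC.
exists [set fr].
  move=> _ -> _ /mapP[e ef ->] /=; rewrite eS.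
  by apply: dual_monoidD => //; apply: dk => //; exact: ek.
move=> x g xg; have [_ [/= g0 gM]] := (coords_chart_point xg).
have frE : eval_regular fr g = \sum_(e <- f) e.1 *
    g (e.2 + k.+1%:Z *: (vpt r - vpt p)) by rewrite /eval_regular big_map.
have [grp|grp] := eqVneq (g (vpt r - vpt p)) 0.
  split=> [_ _ ->|_ c xE].
    rewrite frE big_seq big1 // => e ef.
    by rewrite eS gM ?grp ?mulr0 //; apply: dk => //; exact: ek.
  have := (coords_supp (vpt p) xg).1; rewrite grp xE supp_pt => h'.
  by have [] := h' (fset_vtx _ _ _).
have xp : supp hP x (vpt p).
  by apply/(coords_supp _ xg); split; [exact: lat_vtx|exact/eqP].
have [c xE] := (supp_chart hP x p).1 xp.
have hE : eval_regular fr g = g (vpt r - vpt p) ^+ k.+1 * h c.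
  rewrite frE fE /eval_regular mulr_sumr; apply: eq_big_seq => e ef.
  rewrite mulrCA; congr (_ * _); move: xg; rewrite xE => -[_ _ [d /= [dc dp dr']]].
  have [d0 dM] := dc.
  have sp m : dual_monoid (cone p set0) m ->
      dual_monoid (cone p set0 `&` cone r J) m.
    by apply: dual_monoidS => w [].
  have sr m : dual_monoid (cone r J) m ->
      dual_monoid (cone p set0 `&` cone r J) m.
    by apply: dual_monoidS => w [].
  rewrite -dr'; last by rewrite eS; apply: dual_monoidD => //; apply: dk => //; exact: ek.
  rewrite dM; [|by apply: sp; exact: freg|by apply: dual_monoidZ; exact: sr].
  rewrite (chart_scale _ dc); last exact: sr.
  by rewrite dp ?dr' // 1?mulrC //; exact: freg.
split=> [/(_ c xE) hc _ ->|/(_ _ erefl)]; first by rewrite hE hc mulr0.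
rewrite hE => /eqP; rewrite mulf_eq0 expf_eq0 (negbTE grp) andbF /= => /eqP hc c'.
by rewrite xE => /pt_inj <-.
Qed.

Lemma regfun_mul h1 h2 : regfun h1 -> regfun h2 -> regfun (fun c => h1 c * h2 c).
Proof.
move=> [f1 r1 E1] [f2 r2 E2].
exists [seq (e.1 * e'.1, e.2 + e'.2) | e <- f1, e' <- f2].
  move=> _ /allpairsP[[e e'] /= [ef ef' ->]].
  by apply: dual_monoidD; [exact: r1|exact: r2].
move=> c; rewrite E1 E2 /eval_regular big_allpairs_dep /= mulr_suml.
apply: eq_big_seq => e ef; rewrite mulr_sumr; apply: eq_big_seq => e' ef' /=.
have [_ gM] := chart_monz_vtx hP p c.
by rewrite (gM _ _ (r1 _ ef) (r2 _ ef')) mulrACA.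
Qed.

Lemma regfun_add h1 h2 : regfun h1 -> regfun h2 -> regfun (fun c => h1 c + h2 c).
Proof.
move=> [f1 r1 E1] [f2 r2 E2]; exists (f1 ++ f2).
  by move=> e; rewrite mem_cat => /orP[/r1|/r2].
by move=> c; rewrite E1 E2 /eval_regular big_cat.
Qed.

Lemma regfun_cst (k : K) : regfun (fun=> k).
Proof.
exists [:: (k, 0)]; first by move=> e; rewrite inE => /eqP ->; exact: dual_monoid0.
by move=> c; rewrite /eval_regular big_seq1 monz0 mulr1.
Qed.

Lemma regfun_exp h (k : nat) : regfun h -> regfun (fun c => h c ^+ k).
Proof.
move=> hr; elim: k => [|k IH]; first exact: regfun_cst.
have -> : (fun c => h c ^+ k.+1) = (fun c => h c * h c ^+ k).
  by apply/funext => c; rewrite exprS.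
exact: regfun_mul.
Qed.

Lemma regfun_sum (I : Type) (s : seq I) (Q : pred I) (h : I -> ('I_n -> K) -> K) :
  (forall i, regfun (h i)) -> regfun (fun c => \sum_(i <- s | Q i) h i c).
Proof.
move=> hr; elim: s => [|i s IH].
  have -> : (fun c => \sum_(i <- [::] | Q i) h i c) = fun=> 0.
    by apply/funext => c; rewrite big_nil.
  exact: regfun_cst.
have -> : (fun c => \sum_(j <- i :: s | Q j) h j c) =
    (fun c => (if Q i then h i c else 0) + \sum_(j <- s | Q j) h j c).
  by apply/funext => c; rewrite big_cons; case: ifP => //; rewrite add0r.
by apply: regfun_add => //; case: (Q i) => //; exact: regfun_cst.
Qed.

(** The ring of regular functions on the part of [Z] in [U_p] is a domain. *)
Lemma irreducible_mulf Z h1 h2 : irreducible Z -> regfun h1 -> regfun h2 ->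
    (forall c, Z (pt p c) -> h1 c * h2 c = 0) ->
    (exists2 c, Z (pt p c) & h1 c <> 0) ->
  forall c, Z (pt p c) -> h2 c = 0.
Proof.
move=> [_ Zirr] r1 r2 h12 [c1 Zc1 h1c1] c Zc.
have [|Z1|Z2] := Zirr _ _ (@vanishing_closed _ r1) (@vanishing_closed _ r2).
- move=> x Zx; have [[d xE]|nx] := pselect (exists d, x = pt p d); last first.
    by left=> d xE; case: nx; exists d.
  subst x; have /eqP := h12 d Zx; rewrite mulf_eq0.
  by case/orP => /eqP hd; [left|right] => d' /pt_inj <-.
- by case: h1c1; exact: Z1 Zc1 _ erefl.
- exact: Z2 Zc _ erefl.
Qed.

Section Independence.
Variables (N : nat) (f : nat -> ('I_n -> K) -> K).

(* \sum l [:: s_k; ..; s_1] f_(k-1)^s_k .. f_0^s_1 over exponents below N *)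
Fixpoint poly_value k (l : seq nat -> K) c : K :=
  if k is k'.+1 then
    \sum_(i < N) f k' c ^+ i * poly_value k' (fun s => l (nat_of_ord i :: s)) c
  else l [::].

Lemma regfun_poly_value k l : (forall i, (i < k)%N -> regfun (f i)) ->
  regfun (poly_value k l).
Proof.
elim: k l => [|k IH] l fr /=; first exact: regfun_cst.
apply: regfun_sum => i; apply: regfun_mul; first by apply: regfun_exp; exact: fr.
by apply: IH => j jk; apply: fr; exact: ltnW.
Qed.

Lemma poly_value0 k l c :
    (forall s, size s = k -> all (fun i => (i < N)%N) s -> l s = 0) ->
  poly_value k l c = 0.
Proof.
elim: k l => [|k IH] l l0 /=; first exact: l0.
rewrite big1 // => i _; rewrite IH ?mulr0 // => s sk sN.
by apply: l0; rewrite /= ?sk // ltn_ord.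
Qed.

(* If f_k vanishes on Z_k but not on Z_(k+1), then f_0, .., f_k satisfy no
   polynomial relation on Z_(k+1): divide by the lowest power of f_k and restrict
   to Z_k. *)
Lemma chain_independent k (Z : nat -> set X) l c0 : Z 0%N (pt p c0) ->
    (forall i, (i <= k)%N -> irreducible (Z i)) ->
    (forall i, (i < k)%N -> [/\ regfun (f i), Z i `<=` Z i.+1,
       forall c, Z i (pt p c) -> f i c = 0 &
       exists2 c, Z i.+1 (pt p c) & f i c <> 0]) ->
    (forall c, Z k (pt p c) -> poly_value k l c = 0) ->
  forall s, size s = k -> all (fun i => (i < N)%N) s -> l s = 0.
Proof.
move=> Z0; elim: k l => [|k IH] l Zirr Zf lZ s.
  by move=> /size0nil -> _; exact: lZ Z0.
case: s => // i s [sk] /= /andP[iN sN].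
have fr j : (j < k)%N -> regfun (f j) by move=> jk; case: (Zf j (ltnW jk)).
have [fkr Zk fk0 [c1 Zc1 fc1]] := Zf k (ltnSn k).
have [i'] := ubnP i; elim: i' i iN s sk sN => // i' IHi i iN s sk sN ii'.
pose H j := poly_value k (fun s => l (j :: s)).
have H0 (j : 'I_N) c : (j < i)%N -> H j c = 0.
  move=> ji; apply: poly_value0 => s' s'k s'N.
  by apply: IHi => //; exact: leq_trans ji _.
have {}IH := IH (fun s => l (i :: s)); apply: IH => //.
- by move=> j jk; apply: Zirr; exact: leqW.
- by move=> j jk; apply: Zf; exact: ltnW.
move=> c Zc.
(* With the powers below [i] already gone, the relation is [f k ^ i] times [H i + f k * G]; the
   predecessor accounts for the factor [f k] in front of [G]. *)
pose G c := \sum_(j < N | (i < j)%N) f k c ^+ (j - i).-1 * H j c.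
have Gr : regfun G.
  apply: regfun_sum => j; apply: regfun_mul; first exact: regfun_exp.
  exact: regfun_poly_value.
have sumE c' : poly_value k.+1 l c' = f k c' ^+ i * (H i c' + f k c' * G c').
  rewrite /= (bigID (fun j : 'I_N => (j < i)%N)) /= big1 ?add0r => [|j ji]; last first.
    by rewrite -/(H j c') H0 ?mulr0.
  rewrite (bigD1 (Ordinal iN)) -?leqNgt //= mulrDr; congr (_ + _).
  rewrite /G !mulr_sumr; apply: eq_big => [j|j ij].
    by rewrite -leqNgt -val_eqE /= [in RHS]ltn_neqAle eq_sym andbC.
  rewrite !mulrA -exprSr -exprD; congr (_ ^+ _ * _).
  by move: ij; rewrite -leqNgt -val_eqE /=; lia.
suff /(_ c (Zk _ Zc)) : forall c, Z k.+1 (pt p c) -> H i c + f k c * G c = 0.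
  by rewrite fk0 // mul0r addr0.
apply: (irreducible_mulf (h1 := fun c => f k c ^+ i)).
- exact: Zirr.
- exact: regfun_exp.
- by apply: regfun_add; [exact: regfun_poly_value|exact: regfun_mul].
- by move=> c' Zc'; rewrite -sumE lZ.
- by exists c1 => //; apply/eqP; rewrite expf_neq0 //; apply/eqP.
Qed.

End Independence.
End ChartFunctions.

(** * The subvariety of a 2-face has dimension 2 *)

Section Surfaces.
Context {R : realType} {n : nat} {P : set 'rV[R]_n}.
Hypothesis hP : smooth_full_dim_lattice_polytope P.
Context (K : closedFieldType).
Local Notation b := (bvec hP).
Local Notation a := (acoef hP).
Local Notation cone := (cone hP).
Local Notation Sigma := (outer_normal_fan P).
Local Notation X := (toric_variety K Sigma).
Local Notation pt := (@pt R n P hP K).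
Local Notation supp := (@supp R n P hP K).
Local Notation zset := (@zset R n P hP K).
Local Notation monz := (@monz R n P hP K).
Implicit Types (m : 'rV[int]_n) (c : 'I_n -> K) (h : ('I_n -> K) -> K).
Variables (q : vtx P) (i j : 'I_n).
Hypothesis ij : i != j.
Local Notation A := (fset_at hP q [set k | k = i \/ k = j]).

Section Span.
Variable p : vtx P.
Hypothesis Ap : A (vpt p).

(** Exponents are measured at [q], where the 2-face is a coordinate plane, although the functions
    live on [U_p]; they may be negative there, hence the absolute values. *)
Definition box (D : nat) m : Prop :=
  [/\ dual_monoid (cone p set0) m, forall l, l != i -> l != j -> a q l m = 0,
      (absz (a q i m) <= D)%N & (absz (a q j m) <= D)%N].

(* functions that restrict on the surface to combinations of the chi^m with m
   in a box of size D in the plane of the 2-face *)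
Definition span (D : nat) h : Prop :=
  exists2 f : seq (K * 'rV[int]_n), forall e, e \in f -> box D e.2 &
    forall c, zset A (pt p c) -> h c = eval_regular f (monz p c).

Lemma span_le D D' h : (D <= D')%N -> span D h -> span D' h.
Proof.
move=> DD [f fD fE]; exists f => // e /fD[e1 e2 e3 e4].
by split=> //; exact: leq_trans DD.
Qed.

Lemma span_mul D D' h h' : span D h -> span D' h' ->
  span (D + D') (fun c => h c * h' c).
Proof.
move=> [f fD fE] [f' fD' fE'].
have absD (x y : int) : (absz x <= D -> absz y <= D' -> absz (x + y)%R <= D + D')%N.
  by lia.
exists [seq (e.1 * e'.1, e.2 + e'.2) | e <- f, e' <- f'].
  move=> _ /allpairsP[[e e'] /= [/fD[e1 e2 e3 e4] /fD'[e1' e2' e3' e4'] ->]].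
  split; [exact: dual_monoidD|move=> l li lj|rewrite acoefD; exact: absD..].
  by rewrite acoefD e2 ?e2' ?addr0.
move=> c Ac; rewrite fE // fE' // /eval_regular big_allpairs_dep /= mulr_suml.
apply: eq_big_seq => e /fD[e1 _ _ _]; rewrite mulr_sumr.
apply: eq_big_seq => e' /fD'[e1' _ _ _] /=.
have [_ gM] := chart_monz_vtx hP p c.
by rewrite (gM _ _ e1 e1') mulrACA.
Qed.

Lemma span_exp D h (k : nat) : span D h -> span (k * D) (fun c => h c ^+ k).
Proof.
move=> hD; elim: k => [|k IH].
  exists [:: (1, 0)] => [e|c _]; last by rewrite /eval_regular big_seq1 monz0 mulr1.
  rewrite inE => /eqP -> /=.
  by split; [exact: dual_monoid0|move=> l _ _; exact: acoef0|rewrite acoef0..].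
rewrite mulSn.
have -> : (fun c => h c ^+ k.+1) = (fun c => h c * h c ^+ k).
  by apply/funext => c; rewrite exprS.
exact: span_mul.
Qed.

(** On the surface the only nonzero coordinates at [p] belong to edges inside the face, so a
    nonvanishing character lies in the plane of the face. *)
Lemma monz_off_face c m : zset A (pt p c) -> dual_monoid (cone p set0) m ->
  monz p c m <> 0 -> forall l, l != i -> l != j -> a q l m = 0.
Proof.
move=> Ac sm /monz_neq0 cm l li lj.
have nl : ~ [set k | k = i \/ k = j] l.
  by case=> /eqP; [rewrite (negbTE li)|rewrite (negbTE lj)].
rewrite /acoef (pairing_bvec hP p) big1 // => k _; rewrite -/(a q l (b p k)).
have [ck|ck] := eqVneq (c k) 0; first by rewrite cm ?mul0r.
have [_ /(_ l nl)] : A (vpt p - b p k) by apply: Ac; apply/supp_edge.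
have [_ /(_ l nl)] := Ap.
by rewrite !acoefB => h1 h2; rewrite [a q l (b p k)](_ : _ = 0) ?mulr0 //; lia.
Qed.

Lemma regfun_span h : regfun hP p h -> exists D, span D h.
Proof.
move=> [f freg fE].
pose onface (e : K * 'rV[int]_n) :=
  [forall l, (l != i) ==> (l != j) ==> (a q l e.2 == 0)].
exists (\sum_(e <- f) (absz (a q i e.2) + absz (a q j e.2)))%N.
exists [seq e <- f | onface e].
  move=> e; rewrite mem_filter => /andP[/forallP eA ef]; split.
  - exact: freg.
  - by move=> l li lj; have := eA l; rewrite li lj => /eqP.
  - by rewrite (big_rem e ef) /=; lia.
  - by rewrite (big_rem e ef) /=; lia.
move=> c Ac; rewrite fE /eval_regular big_filter [LHS](bigID onface) /=.
rewrite [X in _ + X]big1_seq ?addr0 // => e /andP[nA ef].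
have [->|/eqP me] := eqVneq (monz p c e.2) 0; first by rewrite mulr0.
case/negP: nA; apply/forallP => l; apply/implyP => li; apply/implyP => lj.
by apply/eqP; apply: (monz_off_face Ac) => //; exact: freg.
Qed.

Lemma span_dependent (T : finType) D (h : T -> ('I_n -> K) -> K) :
    (forall t, span D (h t)) -> (D.*2.+1 ^ 2 < #|T|)%N ->
  exists2 l : T -> K, exists t, l t != 0 &
    forall c, zset A (pt p c) -> \sum_t l t * h t c = 0.
Proof.
move=> hD DT; pose S := ('I_D.*2.+1 * 'I_D.*2.+1)%type.
(* The shift by [D] moves the range from [- D] to [D] onto [0] to [2 * D], whence the [D.*2.+1]
   values in each direction. *)
pose idx m : S := (inord (absz (a q i m + D%:Z)), inord (absz (a q j m + D%:Z))).
pose vec (s : S) := (s.1%:Z - D%:Z) *: b q i + (s.2%:Z - D%:Z) *: b q j.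
have vecK m : box D m -> vec (idx m) = m.
  move=> [_ m0 mi mj]; rewrite /vec /= !inordK; try lia.
  rewrite [RHS](bvec_sum hP q) (bigD1 i) //= (bigD1 j) 1?eq_sym //=.
  rewrite big1 ?addr0 => [|l /andP[li lj]]; last by rewrite m0 ?scale0r.
  by congr (_ *: _ + _ *: _); lia.
pose f t := sval (cid2 (hD t)).
have fD t e : e \in f t -> box D e.2 by rewrite /f; case: cid2 => f' /= + _; apply.
have fE t c : zset A (pt p c) -> h t c = eval_regular (f t) (monz p c).
  by rewrite /f; case: cid2 => f' /= _; apply.
have [|l lt l0] := @linear_dependence K S T
    (fun t s => \sum_(e <- f t | idx e.2 == s) e.1).
  by rewrite card_prod card_ord -mulnn in DT *.
exists l => // c Ac.
have hE t : h t c =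
    \sum_s (\sum_(e <- f t | idx e.2 == s) e.1) * monz p c (vec s).
  rewrite fE // /eval_regular (partition_big (fun e => idx e.2) xpredT) //=.
  apply: eq_bigr => s _; rewrite mulr_suml big_seq_cond [RHS]big_seq_cond.
  by apply: eq_bigr => e /andP[et /eqP <-]; rewrite vecK //; exact: fD et.
under eq_bigr => t _ do rewrite hE mulr_sumr.
rewrite exchange_big big1 // => s _.
under eq_bigr => t _ do rewrite mulrA.
by rewrite -mulr_suml l0 mul0r.
Qed.

End Span.

(** The chain is the flag of [q], its edge [i] and the 2-face. *)
Lemma surface_dim_ge2 : dim_ge (zset A) 2.
Proof.
pose I (k : nat) : set 'I_n :=
  if k is 0 then set0 else if k is 1 then [set i] else [set k | k = i \/ k = j].
exists (fun k => zset (fset_at hP q (I k))); split=> k k2.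
  split; first by split; [exact: zset_closed|exact: zset_irreducible].
  move=> x xI m /xI; apply: fset_sub => l.
  by case: k {k2 xI} => [|[|k]] //= ->; left.
have IS : I k `<=` I k.+1 by case: k k2 => [|[|]] // _ l //= ->; left.
have [l Sl nl] : exists2 l, I k.+1 l & ~ I k l.
  case: k k2 {IS} => [|[|]] // _; [by exists i|exists j; first by right].
  by move=> /= /eqP; rewrite eq_sym (negbTE ij).
split=> [x xI m /xI|sub]; first exact: fset_sub.
apply: nl.
have [x xE] := orbit_exists hP K q (I k.+1).
have : zset (fset_at hP q (I k)) x
  by apply: sub; rewrite /zset /= xE.
move=> /(_ (vpt q - b q l)); rewrite xE => h.
by apply/(fset_edge hP q); apply: h; apply/fset_edge.
Qed.

Lemma cube_gt (N d : nat) : (0 < d)%N -> N = (50 * d ^ 2)%N ->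
  ((7 * (N * d)) ^ 2 < N * N * N)%N.
Proof.
move=> d0 NE; have N0 : (0 < N)%N by rewrite NE muln_gt0 expn_gt0 d0.
rewrite !expnMn -[(N ^ 2)%N]mulnn mulnCA ltn_pmul2l ?muln_gt0 ?N0 //.
by rewrite NE ltn_pmul2r // expn_gt0 d0.
Qed.

Lemma surface_dim_lt3 : ~ dim_ge (zset A) 3.
Proof.
move=> [Z [Zsub Zlt]].
have [[_ [[x0 Z0] _]] ZA0] := Zsub 0%N isT.
have [p [c0 x0E]] := pt_exists hP x0; subst x0.
have Ap : A (vpt p) by apply: (ZA0 _ Z0); rewrite supp_pt; exact: fset_vtx.
have Zle k : (k < 3)%N -> Z k `<=` Z k.+1 by move=> /Zlt[].
have Zp k : (k <= 3)%N -> Z k (pt p c0).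
  by elim: k => // k IH k3; apply: Zle => //; apply: IH; exact: ltnW.
(* All members of the chain meet the chart of [p], so by irreducibility [Z k.+1] exceeds [Z k]
   already inside that chart, and a regular function there separates them. *)
have /choice[f fP] : forall k, exists h, (k < 3)%N ->
    [/\ regfun hP p h, forall c, Z k (pt p c) -> h c = 0 &
        exists2 c, Z k.+1 (pt p c) & h c <> 0].
  move=> k; have [k3|] := boolP (k < 3)%N; last by exists (fun=> 0).
  have [[Zcl _] _] := Zsub k (ltnW k3); have [[_ Zirr] _] := Zsub k.+1 k3.
  have [c Zc nZc] : exists2 c, Z k.+1 (pt p c) & ~ Z k (pt p c).
    apply: contrapT => nc; have [_ Zk] := Zirr.
    case: (Zk (Z k) (zset (~` [set vpt p])) Zcl) => [|x Zx||].
    - exact: zset_closed.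
    - have [xp|nxp] := pselect (supp x (vpt p)); last by right; apply/zset_avoid.
      have [c xE] := (supp_chart hP x p).1 xp; subst x; left.
      by apply: contrapT => nZx; apply: nc; exists c.
    - by have [_] := Zlt k k3.
    - move=> /(_ _ (Zp _ k3)) /zset_avoid; apply.
      by rewrite supp_pt; exact: fset_vtx.
  have [f freg [fc fZ]] := closed_separation Zcl nZc.
  exists (fun c => eval_regular f (monz p c)) => _; split=> //.
    by exists f.
  by exists c.
have spanf k : (k < 3)%N -> exists D, span p D (f k).
  by move=> /fP[fr _ _]; exact: (regfun_span Ap).
have [D0 s0] := spanf 0%N isT; have [D1 s1] := spanf 1%N isT.
have [D2 s2] := spanf 2%N isT.
(* The monomials [h] fit in a box with [(6 * N * D + 1) ^ 2] points, at most
   [49 * N ^ 2 * D.+1 ^ 2]; this [N] makes that less than [N ^ 3]. The successor keeps [N] positive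
   when [D = 0]. *)
pose D := (D0 + D1 + D2)%N; pose N := (50 * D.+1 ^ 2)%N.
pose T := ('I_N * 'I_N * 'I_N)%type.
pose h (t : T) c := f 2%N c ^+ t.1.1 * f 1%N c ^+ t.1.2 * f 0%N c ^+ t.2.
have sp k (x : 'I_N) : (k < 3)%N -> span p (N * D) (fun c => f k c ^+ x).
  move=> k3; apply: (@span_le p (x * D)); first by rewrite leq_mul2r ltnW ?orbT.
  apply: span_exp; case: k k3 => [|[|[|]]] // _.
  - by apply: span_le s0; rewrite /D; lia.
  - by apply: span_le s1; rewrite /D; lia.
  - by apply: span_le s2; rewrite /D; lia.
have [||l [[[x y] z] lt] l0] := @span_dependent p T (N * D + N * D + N * D)%N h.
- by move=> t; apply: span_mul; [apply: span_mul|]; exact: sp.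
- rewrite !card_prod card_ord; have N0 : (0 < N)%N by rewrite muln_gt0 expn_gt0.
  apply: (@leq_ltn_trans ((7 * (N * D.+1)) ^ 2)).
    by rewrite leq_exp2r // -addnn mulnS; lia.
  exact: cube_gt.
(* [poly_value] reads coefficients off exponent lists that start with the exponent of the last
   function, here [f 2]. *)
pose l' (s : seq nat) := if s is [:: x; y; z] then
  if (insub x, insub y, insub z) is (Some x', Some y', Some z')
  then l (x', y', z') else 0 else 0.
suff : l' [:: x : nat; y : nat; z : nat] = 0.
  by rewrite /l' !valK => l00; rewrite l00 eqxx in lt.
apply: (@chain_independent _ _ _ hP K p N f 3 Z l' c0) => //.
- by move=> k k3; have [[_ ]] := Zsub k k3.
- move=> k k3; have [fr f0 fn] := fP k k3; split=> //; exact: Zle.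
- move=> c Zc; have Ac : zset A (pt p c) by have [_] := Zsub 3%N isT; apply.
  rewrite -[RHS](l0 c Ac).
  have -> : \sum_t l t * h t c = \sum_x \sum_y \sum_z l (x, y, z) * h (x, y, z) c.
    by rewrite !pair_bigA /=; apply: eq_bigr => -[[? ?] ?].
  rewrite /=; apply: eq_bigr => x' _; rewrite mulr_sumr.
  apply: eq_bigr => y' _; rewrite !mulr_sumr.
  by apply: eq_bigr => z' _; rewrite !valK /h /=; ring.
by rewrite /= !ltn_ord.
Qed.

Lemma surface_krull_dim : krull_dim (zset A) 2.
Proof. by split; [exact: surface_dim_ge2|exact: surface_dim_lt3]. Qed.

End Surfaces.

Theorem proposition6p16 (K : closedFieldType) (R : realType) (n : nat)
  (P : set 'rV[R]_n) (hP : smooth_full_dim_lattice_polytope P)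
  (v : 'rV[int]_n) (hv : admissible K (outer_normal_fan P) v) :
  let X := toric_variety K (outer_normal_fan P) in
  stratifies v [set: X] <->
  (forall Y : set X,
     subvariety Y -> T_stable Y -> krull_dim Y 2 -> stratifies v Y).
Proof.
move=> X; have v_edge := admissible_edge hP hv; have [p0] := vtx_inh hP.
(* [X] is treated as the subvariety of the face [P], spanned by all edges at any vertex, so one
   criterion serves both sides. *)
have XE : [set: X] = zset hP (fset_at hP p0 setT).
  by apply/seteqP; split=> // x _ m [Pm _]; rewrite fset_setT.
rewrite XE; split=> [/(stratifies_zset K v_edge) strat Y Ysub Yst _|strat].
  have [r [I ->]] := stable_subvariety hP Ysub Yst.
  apply/(stratifies_zset K v_edge) => p q Ap Aq pq m [qm Am].
  apply: (strat p q) => //; rewrite fset_setT; [exact: lat_vtx..|].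
  by split=> //; case: Am.
apply/(stratifies_zset K v_edge) => p q _ _ pq m [qm _].
apply: (flow_closed_2faces v_edge) pq m qm => r i j ij.
apply/(stratifies_zset K v_edge); apply: strat.
- by split; [exact: zset_closed|exact: zset_irreducible].
- exact: zset_stable.
- exact: surface_krull_dim.
Qed.
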